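(* Let $H_1$ and $H_2$ be closed subspaces of a Gaussian Hilbert space $H$, with maximal correlation $\rho:=\rho(H_1,H_2)$. Suppose $Y_1$ and $Y_2$ are two random variables measurable with respect to $\sigma(H_1)$ and $\sigma(H_2)$ respectively, and sharing the same marginal distribution; write $\overline F(x)=\mathbb{P}(Y_1>x)$. Then for any $x\in\mathbb{R}$, $$\mathbb{P}(Y_1>x,\,Y_2>x)\le\mathbb{P}(Y_1>x)^{2/(1+|\rho|)}=\overline F(x)^{2/(1+|\rho|)}.$$ In particular, if two random vectors (with all the marginal distributions of their components identical and continuous at the upper end point) are measurable with respect to $\sigma(H_1)$ and $\sigma(H_2)$ respectively, then they are extremally independent if $|\rho|<1$.
   Context: A (real) Gaussian Hilbert space is a closed subspace of $L^2$ (of the underlying probability space) consisting of centered Gaussian random variables. $\sigma(H_i)$ is the $\sigma$-field generated by the random variables in $H_i$, and $L^2(H_i)$ is the space of square-integrable $\sigma(H_i)$-measurable random variables. The maximal correlation is $$\rho(H_1,H_2)=\sup_{X_1\in L^2(H_1),\,X_2\in L^2(H_2)}\frac{\mathrm{Cov}(X_1,X_2)}{\|X_1\|_2\|X_2\|_2},$$ the ratio being read as $0$ when a denominator vanishes. For a distribution function $F$, the upper end point is $U_F=\sup\{x\in\mathbb{R}:F(x)<1\}$; the distribution is continuous at its upper end point if $\lim_{x\uparrow U_F}F(x)=1$. Two random variables $Y_1,Y_2$ with the same distribution function $F$, continuous at its upper end point, are extremally independent if $\lim_{x\uparrow U_F}\mathbb{P}(Y_1>x,Y_2>x)/\overline F(x)=0$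 where $\overline F=1-F$. Two random vectors, all of whose components have one identical marginal distribution that is continuous at its upper end point, are extremally independent if every pair consisting of a component of the first and a component of the second is extremally independent. *)

(* Defs.v *)
From HB Require Import structures.
From mathcomp Require Export all_boot all_order all_algebra.
From mathcomp Require Export all_classical all_reals all_analysis.

Set Implicit Arguments.
Unset Strict Implicit.
Unset Printing Implicit Defensive.

Import Order.TTheory GRing.Theory Num.Theory.
Import numFieldNormedType.Exports.

Local Open Scope classical_set_scope.
Local Open Scope ring_scope.

Section GaussianHilbertSpace.
Context d (T : measurableType d) (R : realType) (P : probability T R).

(* Elements of [L2] are functions, not classes modulo a.e. equality; a subspace
   of the Hilbert space L^2(P) is represented by the set of all versions of its
   elements, see [closed_subspace]. *)
Definition L2 := LfunType P (lee1n 2).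

Definition norm2 (X : L2) : R := fine ('N[P]_2%:E [EFin \o X])%E.

(* The limit [X] ranges over all functions, so a closed subspace contains every
   [X : L2] that is a.e. equal to one of its elements. *)
Definition closed_subspace (H : set L2) : Prop :=
  submod_closed (mem H) /\
  (forall (X_ : nat -> L2) (X : L2), (forall n, H (X_ n)) ->
     norm2 (X_ n - X) @[n --> \oo] --> 0 -> H X).

Definition has_law (X : T -> R) (mu : set R -> \bar R) : Prop :=
  forall A : set R, measurable A -> pushforward P X A = mu A.

(* The case of variance 0 is separate: [normal_prob 0 0] is not [\d_0]. *)
Definition centered_gaussian (X : T -> R) : Prop :=
  has_law X (\d_(0 : R)) \/
  exists2 s : R, 0 < s & has_law X (normal_prob 0 s).

Definition gaussian_hilbert_space (H : set L2) : Prop :=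
  closed_subspace H /\ forall X, H X -> centered_gaussian X.

Definition sigma_gen (H : set L2) : set (set T) :=
  \bigcup_(X in H) preimage_set_system [set: T] (X : T -> R) measurable.

(* Measurability with respect to sigma(H) = <<s sigma_gen H>>. As a closed
   subspace contains all versions of 0, its sigma-field contains all
   the P-null events. *)
Definition sigma_measurable (H : set L2) d' (U : measurableType d')
    (Y : T -> U) : Prop :=
  measurable_fun [set: g_sigma_algebraType (sigma_gen H)] Y.

Definition L2_of (H : set L2) : set L2 :=
  [set X : L2 | sigma_measurable H (X : T -> R)].

(* In MathComp [x / 0 = 0], so a ratio with zero denominator is 0. *)
Definition maximal_correlation (H1 H2 : set L2) : R :=
  sup [set fine (covariance P X1 X2) / (norm2 X1 * norm2 X2)
      | X1 in L2_of H1 & X2 in L2_of H2].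

End GaussianHilbertSpace.

Section ExtremalIndependence.
Context (R : realType).

Definition distribution_fun (mu : set R -> \bar R) (x : R) : \bar R :=
  mu [set` `]-oo, x]].

Definition upper_end_point (F : R -> \bar R) : \bar R :=
  ereal_sup [set x%:E | x in [set x : R | (F x < 1)%E]].

(* The filter of the limits "x increases to u" with x real; the case -oo does
   not occur for the upper end point of a distribution function. *)
Definition ereal_at_left (u : \bar R) : set_system R :=
  match u with
  | r%:E => r^'-
  | +oo%E => +oo_R
  | -oo%E => -oo_R
  end.

Definition continuous_at_upper_end_point (F : R -> \bar R) : Prop :=
  F x @[x --> ereal_at_left (upper_end_point F)] --> 1%E.

Context d (T : measurableType d) (P : probability T R).

(* [F] is the common distribution function of [Y1] and [Y2]. *)
Definition extremally_independent (F : R -> \bar R) (Y1 Y2 : T -> R) : Prop :=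
  fine (P [set t | x < Y1 t /\ x < Y2 t]) / fine (1 - F x)%E
    @[x --> ereal_at_left (upper_end_point F)] --> 0.

Definition extremally_independent_vectors (F : R -> \bar R) (m n : nat)
    (V1 : T -> m.-tuple R) (V2 : T -> n.-tuple R) : Prop :=
  forall (i : 'I_m) (j : 'I_n),
    extremally_independent F (fun t => tnth (V1 t) i) (fun t => tnth (V2 t) j).

End ExtremalIndependence.

(* Main.v *)
Require Import Defs.
From mathcomp Require Import ring lra measurable_realfun.

Set Implicit Arguments.
Unset Strict Implicit.
Unset Printing Implicit Defensive.

Import Order.TTheory GRing.Theory Num.Theory.
Import numFieldNormedType.Exports.

Local Open Scope classical_set_scope.
Local Open Scope ring_scope.

(* Let [r] be the maximal correlation and [p = 1 + r]. As [H1] and [H2] consist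
   of L^2-functions, |E XY| <= r |X| |Y| for [X] in [H1] and [Y] in [H2], and it
   suffices to show P(A and B) <= (P(A) P(B))^(1/p) for [A] in sigma(H1) and [B]
   in sigma(H2).
   The two-point inequality tensorizes: if (e_i, e'_i) are independent pairs of
   uniform signs with correlation [r], then
   E f(e) g(e') <= (E f(e)^p)^(1/p) (E g(e')^p)^(1/p) for f, g >= 0, hence
   E f(e) g(e') <= (E f(e) E g(e'))^(1/p) when f and g take values in [0, 1].
   Finitely many elements of [H1] and [H2] are limits in law of sums of such
   signs: the kernel with blocks E XX', E XY / r, E YY' is positive semidefinite,
   hence a Gram matrix, whose vectors give the coefficients of the sums. For f
   and g trigonometric polynomials the limit only involves the characteristic
   functions E cos(t + Z) = cos(t) exp(- E Z^2 / 2) of elements [Z] of [H], so no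
   joint law is needed.
   Finally, the events whose indicator is an L^1-limit of [0, 1]-valued
   trigonometric polynomials form a sigma-field, which contains the events
   {a < X} because the iterates of w |-> (3w - w^3)/2, applied to sin((X - a)/k),
   converge to its sign. *)

(** * Elementary inequalities for powers of [1 + y] and [1 - y] *)

Section TwoPointInequality.
Context {R : realType}.

(** By the mean value theorem; the elementary inequalities below follow by applying this to a
    difference. *)
Lemma le_of_derive_ge0 (f df : R -> R) (a b : R) : a <= b ->
  (forall x, a <= x <= b -> is_derive x 1 f (df x)) ->
  (forall x, a <= x <= b -> 0 <= df x) -> f a <= f b.
Proof.
move=> ab fdf df0.
have [|x xab|c cab] := @MVT_segment _ f df _ _ ab.
- by move=> x xab; apply: fdf; move: xab; rewrite in_itv/= => /andP[/ltW-> /ltW->].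
- apply: derivable_within_continuous => y; rewrite in_itv/= => yab.
  exact: (@ex_derive _ _ _ _ _ _ _ (fdf y yab)).
- move=> fba; rewrite -subr_ge0 fba mulr_ge0 ?subr_ge0//.
  by apply: df0; move: cab; rewrite in_itv.
Qed.

(** The product of the two powers is [(1 - y^2)^q >= 1] because [q <= 0]; the arithmetic-geometric
    mean inequality then bounds their sum. *)
Lemma sum_powR_ge2 (q y : R) : q <= 0 -> 0 <= y < 1 ->
  2 <= (1 + y) `^ q + (1 - y) `^ q.
Proof.
move=> q0 /andP[y0 y1].
set u := _ `^ q; set v := _ `^ q.
have u0 : 0 < u by apply: powR_gt0; lra.
have v0 : 0 < v by apply: powR_gt0; lra.
have uv : 1 <= u * v.
  rewrite /u /v -powRM; [|lra|lra].
  rewrite -[leLHS](powRr0 ((1 + y) * (1 - y))); apply: ger_powR => //.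
  by apply/andP; split; nra.
have : 0 <= (u - v) ^+ 2 by exact: sqr_ge0.
by move=> ?; nra.
Qed.

(** Right minus left vanishes at 0 together with its derivative, and its second derivative is a
    nonnegative multiple of [(1 + y)^(p - 2) + (1 - y)^(p - 2) - 2], to which [sum_powR_ge2]
    applies. *)
Lemma powR_even_part_ge (p y : R) : 1 <= p <= 2 -> 0 <= y <= 1 ->
  1 + p * (p - 1) / 2 * y ^+ 2 <= ((1 + y) `^ p + (1 - y) `^ p) / 2.
Proof.
move=> /andP[p1 p2].
have powD (a : R) (x : R) : 0 < 1 + x ->
    is_derive x 1 (fun x => (1 + x) `^ a) (a * (1 + x) `^ (a - 1)).
  move=> x1; have h := is_derive1_powR a x1.
  have e : is_derive x 1 (fun x : R => 1 + x) 1.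
    by apply: is_derive_eq; ring.
  have := is_derive1_comp (f := fun u : R => u `^ a) (g := fun x : R => 1 + x) h e.
  by rewrite mulr1.
have powB (a : R) (x : R) : 0 < 1 - x ->
    is_derive x 1 (fun x => (1 - x) `^ a) (- (a * (1 - x) `^ (a - 1))).
  move=> x1; have h := is_derive1_powR a x1.
  have e : is_derive x 1 (fun x : R => 1 - x) (-1).
    by apply: is_derive_eq; ring.
  have := is_derive1_comp (f := fun u : R => u `^ a) (g := fun x : R => 1 - x) h e.
  by rewrite mulrN1.
pose c := p * (p - 1) / 2.
have c0 : 0 <= c by rewrite /c; nra.
have main z : 0 <= z < 1 -> 1 + c * z ^+ 2 <= ((1 + z) `^ p + (1 - z) `^ p) / 2.
  move=> /andP[z0 z1].
  pose g x := (p * (1 + x) `^ (p - 1) - p * (1 - x) `^ (p - 1)) / 2 - c * 2 * x.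
  have g_ge0 t : 0 <= t < 1 -> 0 <= g t.
    move=> /andP[t0 t1].
    have -> : 0 = g 0 by rewrite /g addr0 subr0 powR1; ring.
    apply: (@le_of_derive_ge0 g (fun x => (p * ((p - 1) * (1 + x) `^ (p - 1 - 1))
      - p * (- ((p - 1) * (1 - x) `^ (p - 1 - 1)))) / 2 - c * 2) _ _ t0) => x /andP[x0 xt].
      have h1 : 0 < 1 + x by lra.
      have h2 : 0 < 1 - x by lra.
      have d1 := powD (p - 1) x h1; have d2 := powB (p - 1) x h2.
      rewrite /g; apply: is_derive_eq.
      by rewrite /GRing.scale/=; ring.
    have := @sum_powR_ge2 (p - 1 - 1) x; rewrite x0 (le_lt_trans xt t1) => /(_ _ isT).
    have -> : p - 1 - 1 <= 0 by lra.
    move=> /(_ isT); rewrite -subr_ge0 => /(mulr_ge0 c0) h.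
    apply: (le_trans h); rewrite le_eqVlt; apply/orP; left; apply/eqP.
    by rewrite /c; field.
  pose h x := ((1 + x) `^ p + (1 - x) `^ p) / 2 - (1 + c * x ^+ 2).
  rewrite -subr_ge0 -/(h z).
  have -> : 0 = h 0 by rewrite /h addr0 subr0 powR1; field.
  apply: (@le_of_derive_ge0 h g _ _ z0) => x /andP[x0 xz]; last first.
    by apply: g_ge0; rewrite x0 (le_lt_trans xz).
  have h1 : 0 < 1 + x by lra.
  have h2 : 0 < 1 - x by lra.
  have d1 := powD p x h1; have d2 := powB p x h2.
  rewrite /h /g; apply: is_derive_eq.
  by rewrite /GRing.scale/=; ring.
move=> /andP[y0 y1].
have [->|yn1] := eqVneq y 1; last first.
  by apply: main; rewrite y0 lt_neqAle yn1.
have le2p (z : R) : 0 <= z <= 1 -> z `^ p <= z.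
  move=> /andP[z0 z1]; have [->|zn0] := eqVneq z 0.
    by rewrite powR0// gt_eqF//; lra.
  by apply: ge1r_powR; rewrite // z1 lt_neqAle eq_sym zn0 z0.
have P2 : 0 <= (1 + 1 : R) `^ p by exact: powR_ge0.
rewrite subrr powR0 ?addr0; last by rewrite gt_eqF//; lra.
rewrite expr1n mulr1 -/c.
apply/ler_addgt0Pr => e e0.
(* At [y = 1], outside the range of the derivative formula for [(1 - x)^p], the bound at [1 - d] is
   used; it loses at most [d / 2 + 2 c d <= e]. *)
pose d := Num.min 1 (e / (1 + 2 * c)).
have d0 : 0 < d by rewrite lt_min ltr01/= divr_gt0//; lra.
have d1 : d <= 1 by rewrite ge_min lexx.
have de : d * (1 + 2 * c) <= e.
  by rewrite -ler_pdivlMr ?ge_min ?lexx ?orbT//; lra.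
have := main (1 - d); have -> : 0 <= 1 - d < 1 by apply/andP; split; lra.
move=> /(_ isT).
have : (1 + (1 - d)) `^ p <= (1 + 1) `^ p.
  by apply: ge0_ler_powR; rewrite ?nnegrE; lra.
have := le2p (1 - (1 - d)); have -> : 0 <= 1 - (1 - d) <= 1 by apply/andP; split; lra.
move=> /(_ isT) h1 h2 h3.
have h4 : (1 - d) ^+ 2 >= 1 - 2 * d by nra.
have : c * (1 - 2 * d) <= c * (1 - d) ^+ 2 by rewrite ler_wpM2l.
by nra.
Qed.

End TwoPointInequality.

(** * The hypercontractive two-point inequality *)

Section BonamiTwoPoint.
Context {R : realType}.

(** Bernoulli's inequality for an exponent in [0, 1]: the difference has derivative
    [s (1 - (1 + z)^(s - 1)) >= 0]. *)
Lemma powR_onePx_le (s x : R) : 0 <= s <= 1 -> 0 <= x ->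
  (1 + x) `^ s <= 1 + s * x.
Proof.
move=> /andP[s0 s1] x0; pose h z := 1 + s * z - (1 + z) `^ s.
rewrite -subr_ge0 -/(h x).
have -> : 0 = h 0 by rewrite /h !addr0 powR1 mulr0 addr0 subrr.
apply: (@le_of_derive_ge0 R h (fun z => s - s * (1 + z) `^ (s - 1)) _ _ x0) => z /andP[z0 _].
  have z1 : 0 < 1 + z by lra.
  have d := is_derive1_powR s z1.
  have e : is_derive z 1 (fun z : R => 1 + z) 1 by apply: is_derive_eq; ring.
  have c := is_derive1_comp (f := (fun u : R => u `^ s)) (g := fun z : R => 1 + z) d e.
  by rewrite /h; apply: is_derive_eq; rewrite /GRing.scale/=; ring.
have : (1 + z) `^ (s - 1) <= 1.
  by rewrite -[leRHS](powRr0 (1 + z)); apply: ler_powR; lra.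
by move=> ?; nra.
Qed.

(* The two-point inequality of Bonami, Gross and Beckner between the exponents
   [1 + r] and [2], for the function with values [a] and [b]. *)
Lemma bonami_two_point (r a b : R) : 0 <= r <= 1 -> 0 <= a -> 0 <= b ->
  Num.sqrt (((a + b) / 2) ^+ 2 + r * ((a - b) / 2) ^+ 2) <=
  ((a `^ (1 + r) + b `^ (1 + r)) / 2) `^ (1 + r)^-1.
Proof.
move=> /andP[r0 r1]; wlog ab : a b / b <= a => [hw a0 b0|a0 b0].
  have [ba|/ltW ab] := leP b a; first exact: hw.
  rewrite (addrC a) (addrC (a `^ _)) (_ : ((a - b) / 2) ^+ 2 = ((b - a) / 2) ^+ 2).
    exact: hw.
  by field.
pose p := 1 + r; rewrite -/p.
have [a_eq0|a_neq0] := eqVneq a 0.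
  have -> : b = 0 by lra.
  by rewrite a_eq0 subrr addr0 mul0r expr0n/= mulr0 addr0 sqrtr0 powR_ge0.
have {a_neq0} a_gt0 : 0 < a by rewrite lt_neqAle eq_sym a_neq0.
(* Both sides are homogeneous, so after division by the mean [m] the values become [1 + y] and
   [1 - y], and the claim becomes [(1 + r y^2)^(p/2) <= ((1 + y)^p + (1 - y)^p) / 2]. *)
pose m := (a + b) / 2; pose y := (a - b) / (a + b).
have m0 : 0 < m by rewrite /m; lra.
have y01 : 0 <= y <= 1.
  rewrite /y divr_ge0 ?subr_ge0 ?addr_ge0//= ler_pdivrMr; lra.
have [y0 y1] := andP y01.
have aE : a = m * (1 + y) by rewrite /m /y; field; lra.
have bE : b = m * (1 - y) by rewrite /m /y; field; lra.
have p0 : 0 < p by rewrite /p; lra.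
rewrite -powR12_sqrt; last by rewrite addr_ge0 ?sqr_ge0// mulr_ge0 ?sqr_ge0.
set q := _ + _.
have q0 : 0 <= q by rewrite addr_ge0 ?sqr_ge0// mulr_ge0 ?sqr_ge0.
have -> : q `^ 2^-1 = q `^ (p / 2) `^ p^-1.
  by rewrite -powRrM; congr (_ `^ _); field; lra.
apply: ge0_ler_powR; rewrite ?nnegrE ?powR_ge0 ?invr_ge0 ?(ltW p0)//.
  by rewrite divr_ge0 ?addr_ge0 ?powR_ge0.
have -> : q = m ^+ 2 * (1 + r * y ^+ 2) by rewrite /q /m /y; field; lra.
rewrite powRM ?sqr_ge0//; last by rewrite addr_ge0// mulr_ge0// sqr_ge0.
have -> : (m ^+ 2) `^ (p / 2) = m `^ p.
  by rewrite -powR_mulrn ?ltW// -powRrM; congr (_ `^ _); field.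
have powE z : 0 <= z -> (m * z) `^ p = m `^ p * z `^ p.
  by move=> z0; rewrite powRM// ltW.
rewrite aE bE !powE; [|lra|lra].
rewrite -mulrDr -mulrA ler_wpM2l ?powR_ge0//.
(* As [r = p - 1], Bernoulli's bound [1 + (p/2) r y^2] is exactly the left side of
   [powR_even_part_ge]. *)
have := @powR_onePx_le (p / 2) (r * y ^+ 2).
have -> : 0 <= p / 2 <= 1 by rewrite /p; apply/andP; split; lra.
rewrite mulr_ge0 ?sqr_ge0// => /(_ isT isT) h; apply: (le_trans h).
have := @powR_even_part_ge R p y.
have -> : 1 <= p <= 2 by rewrite /p; apply/andP; split; lra.
rewrite y01 => /(_ isT isT); apply: le_trans.
rewrite le_eqVlt; apply/orP; left; apply/eqP.
by rewrite /p; ring.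
Qed.

(** Lagrange's identity: the product of the two forms minus the square of the left side is
    [r (u z - v w)^2]. *)
Lemma cauchy_schwarz_weighted (r u v w z : R) : 0 <= r ->
  u * w + r * (v * z) <= Num.sqrt (u ^+ 2 + r * v ^+ 2) * Num.sqrt (w ^+ 2 + r * z ^+ 2).
Proof.
move=> r0; set A := u ^+ 2 + _; set B := w ^+ 2 + _.
have A0 : 0 <= A by rewrite addr_ge0 ?sqr_ge0// mulr_ge0 ?sqr_ge0.
have B0 : 0 <= B by rewrite addr_ge0 ?sqr_ge0// mulr_ge0 ?sqr_ge0.
rewrite -sqrtrM//; apply: (le_trans (ler_norm _)).
rewrite -sqrtr_sqr ler_wsqrtr// -subr_ge0.
have -> : A * B - (u * w + r * (v * z)) ^+ 2 = r * (u * z - v * w) ^+ 2.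
  by rewrite /A /B; ring.
by rewrite mulr_ge0 ?sqr_ge0.
Qed.

(** In the means and half-differences of [(a, b)] and [(c, d)] the left side is a bilinear form with
    weights 1 and [r]; Cauchy-Schwarz separates the two pairs and [bonami_two_point] treats each. *)
Lemma correlated_two_point (r a b c d : R) : 0 <= r <= 1 ->
  0 <= a -> 0 <= b -> 0 <= c -> 0 <= d ->
  (1 + r) / 4 * (a * c + b * d) + (1 - r) / 4 * (a * d + b * c) <=
  ((a `^ (1 + r) + b `^ (1 + r)) / 2) `^ (1 + r)^-1 *
  ((c `^ (1 + r) + d `^ (1 + r)) / 2) `^ (1 + r)^-1.
Proof.
move=> r01 a0 b0 c0 d0; have [r0 r1] := andP r01.
apply: le_trans (ler_pM (sqrtr_ge0 _) (sqrtr_ge0 _)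
  (bonami_two_point r01 a0 b0) (bonami_two_point r01 c0 d0)).
apply: le_trans (@cauchy_schwarz_weighted r _ _ _ _ r0).
by rewrite le_eqVlt; apply/orP; left; apply/eqP; field.
Qed.

End BonamiTwoPoint.

(** * Walks with correlated signs and tensorization *)

Section CorrelatedWalks.
Context {R : realType}.

(** Expectation of [f (x + sum e_i a_i)] over independent uniform signs [e_i]. *)
Fixpoint walk {V : zmodType} (l : seq V) (f : V -> R) (x : V) : R :=
  if l is a :: l' then (walk l' f (x + a) + walk l' f (x - a)) / 2 else f x.

(* Expectation of [F (x + sum e_i a_i) (y + sum e'_i b_i)] over independent
   pairs of uniform signs [(e_i, e'_i)] with correlation [r]. *)
Fixpoint walk2 {V W : zmodType} (r : R) (l : seq (V * W)) (F : V -> W -> R)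
    (x : V) (y : W) : R :=
  if l is ab :: l' then
    (1 + r) / 4 * (walk2 r l' F (x + ab.1) (y + ab.2) +
                   walk2 r l' F (x - ab.1) (y - ab.2)) +
    (1 - r) / 4 * (walk2 r l' F (x + ab.1) (y - ab.2) +
                   walk2 r l' F (x - ab.1) (y + ab.2))
  else F x y.

Lemma le_walk (V : zmodType) (l : seq V) f g :
  (forall x, f x <= g x) -> forall x, walk l f x <= walk l g x.
Proof.
move=> fg; elim: l => [|a l ih] x //=.
by rewrite ler_wpM2r ?invr_ge0// lerD.
Qed.

Lemma walk_ge0 (V : zmodType) (l : seq V) f :
  (forall x, 0 <= f x) -> forall x, 0 <= walk l f x.
Proof.
move=> f0; elim: l => [|a l ih] x //=.
by rewrite divr_ge0 ?addr_ge0.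
Qed.

(** Tensorization by induction on [l]: the induction hypothesis bounds each of the four
    continuations by a product, and [correlated_two_point], applied to the [1/(1 + r)]-th powers of
    the shorter walks, absorbs the first pair of signs. *)
Lemma walk2_hypercontractive (V W : zmodType) (r : R) (l : seq (V * W)) f g :
  0 <= r <= 1 ->
  (forall x, 0 <= f x) -> (forall y, 0 <= g y) -> forall x y,
  walk2 r l (fun x y => f x * g y) x y <=
  walk (map fst l) (fun x => f x `^ (1 + r)) x `^ (1 + r)^-1 *
  walk (map snd l) (fun y => g y `^ (1 + r)) y `^ (1 + r)^-1.
Proof.
move=> r01 f0 g0; have [r0 r1] := andP r01.
have p0 : 1 + r != 0 by rewrite gt_eqF//; lra.
elim: l => [|[a b] l ih] x y /=.
  by rewrite -!powRrM !mulfV// !powRr1.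
set F := walk _ _; set G := walk _ _.
have F0 z : 0 <= F z by apply: walk_ge0 => ?; exact: powR_ge0.
have G0 z : 0 <= G z by apply: walk_ge0 => ?; exact: powR_ge0.
have := @correlated_two_point R r (F (x + a) `^ (1 + r)^-1) (F (x - a) `^ (1 + r)^-1)
  (G (y + b) `^ (1 + r)^-1) (G (y - b) `^ (1 + r)^-1) r01
  (powR_ge0 _ _) (powR_ge0 _ _) (powR_ge0 _ _) (powR_ge0 _ _).
rewrite -!powRrM !mulVf// !powRr1//; apply: le_trans.
by rewrite lerD ?ler_wpM2l ?lerD ?ih//; lra.
Qed.

(** On [0, 1] one has [f^(1 + r) <= f], so the inner powers are dropped and only plain expectations
    remain, which pass to the limit. *)
Lemma walk2_le (V W : zmodType) (r : R) (l : seq (V * W)) f g :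
  0 <= r <= 1 ->
  (forall x, 0 <= f x <= 1) -> (forall y, 0 <= g y <= 1) -> forall x y,
  walk2 r l (fun x y => f x * g y) x y <=
  (walk (map fst l) f x * walk (map snd l) g y) `^ (1 + r)^-1.
Proof.
move=> r01 f01 g01 x y; have [r0 r1] := andP r01.
have p0 : 0 <= (1 + r)^-1 by rewrite invr_ge0; lra.
have f0 z : 0 <= f z by case/andP: (f01 z).
have g0 z : 0 <= g z by case/andP: (g01 z).
have le_pow (U : zmodType) (h : U -> R) z : 0 <= h z <= 1 -> h z `^ (1 + r) <= h z.
  move=> /andP[h0 h1]; have [->|hn0] := eqVneq (h z) 0.
    by rewrite powR0// gt_eqF//; lra.
  by apply: ge1r_powR; [rewrite h1 lt_neqAle eq_sym hn0 h0|lra].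
apply: (le_trans (walk2_hypercontractive l r01 f0 g0 x y)).
rewrite powRM ?walk_ge0//; apply: ler_pM; rewrite ?powR_ge0//.
- apply: ge0_ler_powR; rewrite ?nnegrE ?walk_ge0//; first by move=> z; exact: powR_ge0.
  by apply: le_walk => z; exact: le_pow.
- apply: ge0_ler_powR; rewrite ?nnegrE ?walk_ge0//; first by move=> z; exact: powR_ge0.
  by apply: le_walk => z; exact: le_pow.
Qed.

(** Each sign of a correlated pair is itself uniform: [(1 + r) / 4 + (1 - r) / 4 = 1 / 2]. *)
Lemma walk2_fst (V W : zmodType) (r : R) (l : seq (V * W)) f x y :
  walk2 r l (fun x _ => f x) x y = walk (map fst l) f x.
Proof. by elim: l x y => [|ab l ih] x y //=; rewrite !ih; field. Qed.

Lemma walk2_snd (V W : zmodType) (r : R) (l : seq (V * W)) g x y :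
  walk2 r l (fun _ y => g y) x y = walk (map snd l) g y.
Proof. by elim: l x y => [|ab l ih] x y //=; rewrite !ih; field. Qed.

Lemma walk2D (V W : zmodType) (r : R) (l : seq (V * W)) F G x y :
  walk2 r l (fun x y => F x y + G x y) x y = walk2 r l F x y + walk2 r l G x y.
Proof. by elim: l x y => [|ab l ih] x y //=; rewrite !ih; ring. Qed.

Lemma walk2Z (V W : zmodType) (r c : R) (l : seq (V * W)) F x y :
  walk2 r l (fun x y => c * F x y) x y = c * walk2 r l F x y.
Proof. by elim: l x y => [|ab l ih] x y //=; rewrite !ih; ring. Qed.

Lemma eq_walk2 (V W : zmodType) (r : R) (l : seq (V * W)) F G x y :
  (forall x y, F x y = G x y) -> walk2 r l F x y = walk2 r l G x y.
Proof. by move=> FG; elim: l x y => [|ab l ih] x y //=; rewrite !ih. Qed.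

End CorrelatedWalks.

(** * Characteristic functions of walks and their central limit theorem *)

Section WalkCharacteristicFunction.
Context {R : realType}.

(** Obtained by integrating [cos <= 1] twice; evenness reduces it to [x >= 0]. *)
Lemma cos_ge_quadratic (x : R) : 1 - x ^+ 2 / 2 <= cos x.
Proof.
wlog x0 : x / 0 <= x => [hw|].
  have [/hw//|/ltW x0] := leP 0 x.
  by rewrite -cosN -sqrrN; apply: hw; rewrite oppr_ge0.
have sin_le (y : R) : 0 <= y -> sin y <= y.
  move=> y0; rewrite -subr_ge0; pose h (z : R) := z - sin z.
  have -> : 0 = h 0 by rewrite /h sin0 subrr.
  by apply: (@le_of_derive_ge0 R h (fun z => 1 - cos z)).
rewrite -subr_ge0; pose h (z : R) := cos z - (1 - z ^+ 2 / 2).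
have -> : 0 = h 0 by rewrite /h cos0; ring.
apply: (@le_of_derive_ge0 R h (fun z => z - sin z)) => // z /andP[z0 _].
  by rewrite /h; apply: is_derive_eq; rewrite /GRing.scale/=; field.
by rewrite subr_ge0 sin_le.
Qed.

(** Two further integrations, starting from [cos_ge_quadratic]. *)
Lemma cos_le_quartic (x : R) : cos x <= 1 - x ^+ 2 / 2 + x ^+ 4 / 24.
Proof.
wlog x0 : x / 0 <= x => [hw|].
  have [/hw//|/ltW x0] := leP 0 x.
  have -> : x ^+ 4 = (- x) ^+ 4 by ring.
  by rewrite -cosN -sqrrN; apply: hw; rewrite oppr_ge0.
have sin_ge (y : R) : 0 <= y -> y - y ^+ 3 / 6 <= sin y.
  move=> y0; rewrite -subr_ge0; pose h (z : R) := sin z - (z - z ^+ 3 / 6).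
  have -> : 0 = h 0 by rewrite /h sin0; ring.
  apply: (@le_of_derive_ge0 R h (fun z => cos z - (1 - z ^+ 2 / 2))) => // z _.
    by rewrite /h; apply: is_derive_eq; rewrite /GRing.scale/=; field.
  by rewrite subr_ge0 cos_ge_quadratic.
rewrite -subr_ge0; pose h (z : R) := 1 - z ^+ 2 / 2 + z ^+ 4 / 24 - cos z.
have -> : 0 = h 0 by rewrite /h cos0; ring.
apply: (@le_of_derive_ge0 R h (fun z => sin z - (z - z ^+ 3 / 6))) => // z /andP[z0 _].
  by rewrite /h; apply: is_derive_eq; rewrite /GRing.scale/=; field.
by rewrite subr_ge0 sin_ge.
Qed.

Lemma expRN_le_quadratic (q : R) : 0 <= q -> expR (- q) <= 1 - q + q ^+ 2 / 2.
Proof.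
move=> q0; rewrite -subr_ge0; pose h (z : R) := 1 - z + z ^+ 2 / 2 - expR (- z).
have -> : 0 = h 0 by rewrite /h oppr0 expR0; ring.
apply: (@le_of_derive_ge0 R h (fun z => z - 1 + expR (- z))) => // z _.
  by rewrite /h; apply: is_derive_eq; rewrite /GRing.scale/=; field.
have := expR_ge1Dx (- z); lra.
Qed.

(** Turns the error of one factor into the error of an [n]-fold product, at the cost of a factor
    [n]. *)
Lemma dist_exprn_le (x y : R) n : `|x| <= 1 -> `|y| <= 1 ->
  `|x ^+ n - y ^+ n| <= n%:R * `|x - y|.
Proof.
move=> x1 y1; elim: n => [|n ih]; first by rewrite subrr normr0 mul0r.
have -> : x ^+ n.+1 - y ^+ n.+1 = x * (x ^+ n - y ^+ n) + (x - y) * y ^+ n.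
  by rewrite !exprS; ring.
rewrite (le_trans (ler_normD _ _))// !normrM -natr1 (mulrDl n%:R) mul1r lerD//.
  by rewrite (le_trans _ ih)// ler_piMl.
by rewrite ler_piMr// normrX exprn_ile1.
Qed.

(* Expectation of [cos (s e + t e')] for uniform signs [e, e'] with
   correlation [r]. *)
Definition sign_cf (r s t : R) : R :=
  (1 + r) / 2 * cos (s + t) + (1 - r) / 2 * cos (s - t).

(** The variance of [s e + t e'], with signs as in [sign_cf]. *)
Definition cov_form (r s t : R) : R := s ^+ 2 + t ^+ 2 + 2 * r * (s * t).

Lemma cov_form_ge0 (r s t : R) : 0 <= r <= 1 -> 0 <= cov_form r s t.
Proof.
move=> /andP[r0 r1].
have -> : cov_form r s t =
    (1 + r) / 2 * (s + t) ^+ 2 + (1 - r) / 2 * (s - t) ^+ 2.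
  by rewrite /cov_form; field.
by rewrite addr_ge0// mulr_ge0 ?sqr_ge0//; lra.
Qed.

Lemma norm_sign_cf_le1 (r s t : R) : 0 <= r <= 1 -> `|sign_cf r s t| <= 1.
Proof.
move=> /andP[r0 r1]; rewrite /sign_cf.
have := cos_le1 (s + t); have := cos_le1 (s - t).
have := cos_geN1 (s + t); have := cos_geN1 (s - t).
by move=> *; rewrite ler_norml; apply/andP; split; nra.
Qed.

(** Both functions agree with [1 - cov_form r s t / 2] up to fourth order, since the average of the
    quadratic terms of the cosines is given by [cov_form]. *)
Lemma sign_cf_approx (r s t : R) : 0 <= r <= 1 ->
  `|sign_cf r s t - expR (- (cov_form r s t / 2))| <=
  ((s + t) ^+ 4 + (s - t) ^+ 4) / 24 + cov_form r s t ^+ 2 / 8.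
Proof.
move=> r01; have [r0 r1] := andP r01.
have Q0 := cov_form_ge0 s t r01.
have QE : cov_form r s t =
    (1 + r) / 2 * (s + t) ^+ 2 + (1 - r) / 2 * (s - t) ^+ 2.
  by rewrite /cov_form; field.
have c1 := cos_ge_quadratic (s + t); have c2 := cos_ge_quadratic (s - t).
have d1 := cos_le_quartic (s + t); have d2 := cos_le_quartic (s - t).
have e1 := expR_ge1Dx (- (cov_form r s t / 2)).
have e2 : expR (- (cov_form r s t / 2)) <=
    1 - cov_form r s t / 2 + cov_form r s t ^+ 2 / 8.
  apply: (le_trans (expRN_le_quadratic _)); first by rewrite divr_ge0.
  by rewrite le_eqVlt; apply/orP; left; apply/eqP; field.
have s4 : 0 <= (s + t) ^+ 4 by rewrite exprn_even_ge0.
have t4 : 0 <= (s - t) ^+ 4 by rewrite exprn_even_ge0.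
have Q2 : 0 <= cov_form r s t ^+ 2 by rewrite sqr_ge0.
have lb : 1 - cov_form r s t / 2 <= sign_cf r s t.
  rewrite /sign_cf QE.
  have := ler_wpM2l (_ : 0 <= (1 + r) / 2) c1; have -> : 0 <= (1 + r) / 2 by lra.
  have := ler_wpM2l (_ : 0 <= (1 - r) / 2) c2; have -> : 0 <= (1 - r) / 2 by lra.
  by move=> /(_ isT) h1 /(_ isT) h2; lra.
have ub : sign_cf r s t <= 1 - cov_form r s t / 2 + ((s + t) ^+ 4 + (s - t) ^+ 4) / 24.
  rewrite /sign_cf QE.
  have := ler_wpM2l (_ : 0 <= (1 + r) / 2) d1; have -> : 0 <= (1 + r) / 2 by lra.
  have := ler_wpM2l (_ : 0 <= (1 - r) / 2) d2; have -> : 0 <= (1 - r) / 2 by lra.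
  move=> /(_ isT) h1 /(_ isT) h2.
  have : (1 - r) / 2 * (s - t) ^+ 4 <= (s - t) ^+ 4 by rewrite ler_piMl//; lra.
  have : (1 + r) / 2 * (s + t) ^+ 4 <= (s + t) ^+ 4 by rewrite ler_piMl//; lra.
  by lra.
rewrite ler_norml; apply/andP; split; lra.
Qed.

(** Central limit theorem for one pair: with arguments divided by [sqrt (n + 1)] each factor errs by
    order [(n + 1)^-2], hence [n + 1] factors err by order [(n + 1)^-1]. *)
Lemma sign_cf_clt (r s t : R) : 0 <= r <= 1 ->
  sign_cf r (s / Num.sqrt n.+1%:R) (t / Num.sqrt n.+1%:R) ^+ n.+1
    @[n --> \oo] --> expR (- (cov_form r s t / 2)).
Proof.
move=> r01; apply/subr_cvg0.
pose C : R := ((s + t) ^+ 4 + (s - t) ^+ 4) / 24 + cov_form r s t ^+ 2 / 8.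
have C0 : (fun n : nat => C * n.+1%:R^-1) @ \oo --> (0 : R).
  by rewrite -(mulr0 C); apply: cvgMr; exact: cvg_harmonic.
apply: norm_cvg0; apply: (squeeze_cvgr _ (cvg_cst 0) C0).
apply: nearW => n; rewrite normr_ge0/=.
set w : R := (Num.sqrt n.+1%:R)^-1.
have n0 : 0 < n.+1%:R :> R by rewrite ltr0n.
have w2 : w ^+ 2 = n.+1%:R^-1 by rewrite exprVn sqr_sqrtr// ltW.
(* The limit is written as an [(n + 1)]-th power too, so that the bases can be compared. *)
have -> : expR (- (cov_form r s t / 2)) =
    expR (- (cov_form r (s * w) (t * w) / 2)) ^+ n.+1.
  rewrite -expRM_natl; congr expR.
  have -> : cov_form r (s * w) (t * w) = cov_form r s t * w ^+ 2.
    by rewrite /cov_form; ring.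
  by rewrite w2; field; rewrite ?gt_eqF// natr1 gt_eqF.
apply: le_trans (dist_exprn_le _ _ _) _.
- exact: norm_sign_cf_le1.
- rewrite ger0_norm ?expR_ge0// -[leRHS]expR0 ler_expR oppr_le0 divr_ge0//.
  exact: cov_form_ge0.
apply: (@le_trans _ _ (n.+1%:R * (C * (w ^+ 2) ^+ 2))).
  rewrite ler_wpM2l//; apply: le_trans (sign_cf_approx _ _ r01) _.
  by rewrite le_eqVlt; apply/orP; left; apply/eqP; rewrite /C /cov_form; field.
by rewrite w2 expr2 mulrCA mulVKf ?gt_eqF.
Qed.

(** Each pair of signs contributes its characteristic function as a factor: the sine terms of the
    addition formulas cancel under a common change of sign. *)
Lemma walk2_cos (V W : zmodType) (r th : R) (l : seq (V * W)) (A : V -> R)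
    (B : W -> R) :
  (forall x y, A (x + y) = A x + A y) -> (forall x, A (- x) = - A x) ->
  (forall x y, B (x + y) = B x + B y) -> (forall x, B (- x) = - B x) ->
  forall x y, walk2 r l (fun x y => cos (th + A x + B y)) x y =
  cos (th + A x + B y) * \prod_(ab <- l) sign_cf r (A ab.1) (B ab.2).
Proof.
move=> AD AN BD BN; elim: l => [|ab l ih] x y /=.
  by rewrite big_nil mulr1.
rewrite !ih big_cons !(AD, AN, BD, BN) /sign_cf.
set a := A ab.1; set b := B ab.2; set p := \prod_(_ <- _) _.
set c := th + A x + B y.
have -> : th + (A x + a) + (B y + b) = c + (a + b) by rewrite /c; ring.
have -> : th + (A x - a) + (B y - b) = c - (a + b) by rewrite /c; ring.
have -> : th + (A x + a) + (B y - b) = c + (a - b) by rewrite /c; ring.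
have -> : th + (A x - a) + (B y + b) = c - (a - b) by rewrite /c; ring.
rewrite (cosD c (a + b)) (cosB c (a + b)) (cosD c (a - b)) (cosB c (a - b)).
by field.
Qed.

(** Each step is repeated [n + 1] times at scale [1 / sqrt (n + 1)], which keeps the covariances of
    the end point independent of [n]. *)
Definition rescaled_walk (V W : lmodType R) (l : seq (V * W)) (n : nat) :=
  flatten (nseq n.+1
    [seq ((Num.sqrt n.+1%:R)^-1 *: ab.1, (Num.sqrt n.+1%:R)^-1 *: ab.2) | ab <- l]).

(** By [walk2_cos] the expectation is a product over steps; repeated steps give [(n + 1)]-th powers,
    and [sign_cf_clt] treats each of the finitely many distinct factors. *)
Lemma rescaled_walk_cos_cvg (V W : lmodType R) (r th : R) (l : seq (V * W))
    (A : V -> R) (B : W -> R) : 0 <= r <= 1 ->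
  (forall c x y, A (c *: x + y) = c * A x + A y) ->
  (forall c x y, B (c *: x + y) = c * B x + B y) ->
  walk2 r (rescaled_walk l n) (fun x y => cos (th + A x + B y)) 0 0
    @[n --> \oo] -->
  cos th * expR (- (\sum_(ab <- l) cov_form r (A ab.1) (B ab.2) / 2)).
Proof.
move=> r01 AL BL.
have AD x y : A (x + y) = A x + A y by rewrite -[x in LHS]scale1r AL mul1r.
have BD x y : B (x + y) = B x + B y by rewrite -[x in LHS]scale1r BL mul1r.
have A0 : A 0 = 0 by apply: (addrI (A 0)); rewrite -AD !addr0.
have B0 : B 0 = 0 by apply: (addrI (B 0)); rewrite -BD !addr0.
have AZ c x : A (c *: x) = c * A x by rewrite -[c *: x]addr0 AL A0 addr0.
have BZ c x : B (c *: x) = c * B x by rewrite -[c *: x]addr0 BL B0 addr0.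
have AN x : A (- x) = - A x by rewrite -scaleN1r AZ mulN1r.
have BN x : B (- x) = - B x by rewrite -scaleN1r BZ mulN1r.
rewrite (_ : (fun n : nat => _) = fun n => cos th * \prod_(ab <- l)
    sign_cf r (A ab.1 / Num.sqrt n.+1%:R) (B ab.2 / Num.sqrt n.+1%:R) ^+ n.+1); last first.
  apply/funext => n; rewrite walk2_cos// A0 B0 !addr0; congr (_ * _).
  have prodE m (s : seq (V * W)) F :
      \prod_(ab <- flatten (nseq m s)) F ab = (\prod_(ab <- s) F ab) ^+ m :> R.
    by elim: m => [|m ih] /=; rewrite ?big_nil ?big_cat/= ?ih ?exprS.
  rewrite prodE big_map prodrXl.
  congr (_ ^+ _); apply: eq_bigr => ab _ /=.
  by rewrite AZ BZ ![_^-1 * _]mulrC.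
apply: cvgMr; elim: l => [|ab l ih].
  rewrite big_nil oppr0 expR0 (_ : (fun _ => _) = cst 1); first exact: cvg_cst.
  by apply/funext => n; rewrite big_nil.
rewrite big_cons opprD expRD (_ : (fun _ => _) = fun n : nat =>
  sign_cf r (A ab.1 / Num.sqrt n.+1%:R) (B ab.2 / Num.sqrt n.+1%:R) ^+ n.+1 *
  \prod_(ab <- l)
    sign_cf r (A ab.1 / Num.sqrt n.+1%:R) (B ab.2 / Num.sqrt n.+1%:R) ^+ n.+1).
  by apply: cvgM => //; exact: sign_cf_clt.
by apply/funext => n; rewrite big_cons.
Qed.

End WalkCharacteristicFunction.

(** * Gram factorization of positive semidefinite kernels on finite sets *)

Section GramFactorization.
Context {R : realType} {J : eqType}.
Implicit Types (K : J -> J -> R) (s : seq (R * J)) (S : seq J).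

Definition quad_form K s : R :=
  \sum_(p <- s) \sum_(q <- s) p.1 * q.1 * K p.2 q.2.

Lemma psd_kernel_eq0 K i j : (forall i j, K i j = K j i) ->
  (forall s, 0 <= quad_form K s) -> K i i = 0 -> K i j = 0.
Proof.
move=> Ksym Kpsd Kii; apply/eqP; apply: contraT => Kij.
(* With this coefficient of [i], chosen for [K i j] nonzero, the form takes the value -1. *)
have := Kpsd [:: (- (K j j + 1) / (2 * K i j), i); (1, j)].
rewrite /quad_form !big_cons !big_nil/= Kii (Ksym j i) !(addr0, mulr0, add0r, mul1r, mulr1).
set a := _ / _.
have -> : a * K i j + (a * K i j + K j j) = -1 by rewrite /a; field.
by rewrite oppr_ge0 ler10.
Qed.

(** Cholesky's algorithm: the rank-one part seen from [i0] is split off, and the Schur complement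
    [K'] is again positive semidefinite. If [K i0 i0 = 0], then [x / 0 = 0] gives [K' = K], and the
    row of [i0] vanishes by [psd_kernel_eq0]. *)
Lemma gram_factorization K S : (forall i j, K i j = K j i) ->
  (forall s, 0 <= quad_form K s) ->
  exists L : seq (J -> R), {in S &, forall i j, \sum_(c <- L) c i * c j = K i j}.
Proof.
elim: S K => [|i0 S ih] K Ksym Kpsd; first by exists [::].
pose k := K i0 i0; pose K' i j := K i j - K i i0 * K i0 j / k.
have k0 : 0 <= k.
  have := Kpsd [:: (1, i0)].
  by rewrite /quad_form !big_cons !big_nil/= !addr0 !mul1r.
have K'sym i j : K' i j = K' j i.
  by rewrite /K' (Ksym i j) (Ksym i i0) (Ksym i0 j) (mulrC (K i0 i)).
have K'psd s : 0 <= quad_form K' s.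
  have [k_eq0|k_neq0] := eqVneq k 0.
    rewrite (_ : K' = K) //; apply/funext => i; apply/funext => j.
    by rewrite /K' k_eq0 invr0 mulr0 subr0.
  pose B := \sum_(p <- s) p.1 * K p.2 i0.
  have BE : \sum_(p <- s) p.1 * K i0 p.2 = B.
    by apply: eq_bigr => p _; rewrite Ksym.
  (* The coefficient [- B / k] of [i0] minimizes the form; the minimum is the form of [K'] at
     [s]. *)
  have := Kpsd ((- B / k, i0) :: s).
  rewrite {1}/quad_form big_cons/= !big_cons/= -/k.
  under [X in _ + X]eq_bigr do rewrite big_cons/=.
  rewrite big_split/= -/(quad_form K s).
  have -> : \sum_(p <- s) - B / k * p.1 * K i0 p.2 = - B / k * B.
    by rewrite -BE mulr_sumr; apply: eq_bigr => p _; rewrite mulrA.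
  have -> : \sum_(p <- s) p.1 * (- B / k) * K p.2 i0 = - B / k * B.
    by rewrite mulr_sumr; apply: eq_bigr => p _; ring.
  suff -> : quad_form K' s = quad_form K s - B ^+ 2 / k.
    congr (_ <= _); field; exact: k_neq0.
  have -> : B ^+ 2 / k =
      \sum_(p <- s) \sum_(q <- s) p.1 * q.1 * (K p.2 i0 * K i0 q.2 / k).
    rewrite expr2 -{2}BE mulrAC mulr_suml; rewrite mulr_suml.
    apply: eq_bigr => p _; rewrite mulr_sumr; apply: eq_bigr => q _.
    by field; exact: k_neq0.
  rewrite /quad_form -sumrB; apply: eq_bigr => p _; rewrite -sumrB.
  by apply: eq_bigr => q _; rewrite /K'; ring.
have [L hL] := ih K' K'sym K'psd.
pose c0 i := K i i0 / Num.sqrt k.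
have c0E i j : c0 i * c0 j = K i i0 * K i0 j / k.
  have [k_eq0|k_neq0] := eqVneq k 0.
    by rewrite /c0 k_eq0 sqrtr0 invr0 !mulr0.
  by rewrite /c0 mulrACA -invfM -expr2 sqr_sqrtr// (Ksym j).
(* The old coordinates are set to 0 at [i0], about which the induction hypothesis says nothing
   unless [i0] is in [S]; [c0] alone then produces the row and column of [i0]. *)
exists (c0 :: [seq (fun j => if j == i0 then 0 else c j) | c : J -> R <- L]).
have K0 j : K i0 i0 * K i0 j / k = K i0 j.
  have [k_eq0|k_neq0] := eqVneq k 0; first by rewrite (psd_kernel_eq0 j Ksym Kpsd k_eq0) mulr0 mul0r.
  by rewrite mulrAC divff// mul1r.
move=> i j; rewrite !inE big_cons big_map c0E.
have [->|ii0] /= := eqVneq i i0.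
  by move=> _ _; rewrite big1 ?addr0// => c _; rewrite mul0r.
have [-> _ _|ji0 /= iS jS] := eqVneq j i0.
  rewrite big1 ?addr0; last by move=> c _; rewrite mulr0.
  by rewrite (Ksym i) -[RHS]K0 (mulrC (K i0 i)).
by rewrite hL// /K' addrC subrK.
Qed.

End GramFactorization.

(** * The algebra of trigonometric polynomials *)

Section TrigPolynomials.
Context {R : realType}.

Definition lin_comb (I : Type) (s : seq (R * I)) (x : I -> R) : R :=
  \sum_(p <- s) p.1 * x p.2.

Lemma lin_comb_cat (I : Type) (s t : seq (R * I)) x :
  lin_comb (s ++ t) x = lin_comb s x + lin_comb t x.
Proof. by rewrite /lin_comb big_cat. Qed.

Lemma lin_combN (I : Type) (s : seq (R * I)) x :
  lin_comb [seq (- p.1, p.2) | p <- s] x = - lin_comb s x.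
Proof.
by rewrite /lin_comb big_map -sumrN; apply: eq_bigr => p _; rewrite mulNr.
Qed.

Lemma lin_comb_linear (I : Type) (s : seq (R * I)) c (x y : I -> R) :
  lin_comb s (c *: x + y) = c * lin_comb s x + lin_comb s y.
Proof.
rewrite /lin_comb mulr_sumr -big_split/=; apply: eq_bigr => p _.
by have -> : (c *: x + y) p.2 = c * x p.2 + y p.2 by []; ring.
Qed.

(* The variables of a trigonometric polynomial are indexed by [I]; a term
   [(a, th, s)] stands for [a * cos (th + sum_((c, i) in s) c * x i)]. *)
Definition trig_eval (I : Type) (t : seq (R * R * seq (R * I))) (x : I -> R) : R :=
  \sum_(m <- t) m.1.1 * cos (m.1.2 + lin_comb m.2 x).

Definition trig_poly (I : Type) (f : (I -> R) -> R) : Prop :=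
  exists t, forall x, f x = trig_eval t x.

Lemma trig_polyD (I : Type) (f g : (I -> R) -> R) :
  trig_poly f -> trig_poly g -> trig_poly (fun x => f x + g x).
Proof.
move=> [t ft] [u gu]; exists (t ++ u) => x.
by rewrite ft gu /trig_eval big_cat.
Qed.

Lemma trig_polyZ (I : Type) c (f : (I -> R) -> R) :
  trig_poly f -> trig_poly (fun x => c * f x).
Proof.
move=> [t ft]; exists [seq (c * m.1.1, m.1.2, m.2) | m <- t] => x.
rewrite ft /trig_eval big_map mulr_sumr.
by apply: eq_bigr => m _; rewrite mulrA.
Qed.

Lemma trig_poly_cst (I : Type) c : trig_poly (fun _ : I -> R => c).
Proof.
exists [:: (c, 0, [::])] => x.
by rewrite /trig_eval big_cons big_nil /lin_comb big_nil/= !addr0 cos0 mulr1.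
Qed.

Lemma trig_poly_cos (I : Type) th c (i : I) :
  trig_poly (fun x => cos (th + c * x i)).
Proof.
exists [:: (1, th, [:: (c, i)])] => x.
by rewrite /trig_eval big_cons big_nil /lin_comb/= big_cons big_nil/= !addr0 mul1r.
Qed.

(** Product-to-sum formula for cosines: [P] collects the sums of the arguments and [Q] their
    differences. *)
Lemma trig_polyM (I : Type) (f g : (I -> R) -> R) :
  trig_poly f -> trig_poly g -> trig_poly (fun x => f x * g x).
Proof.
move=> [t ft] [u gu].
pose P (m n : R * R * seq (R * I)) := (m.1.1 * n.1.1 / 2, m.1.2 + n.1.2, m.2 ++ n.2).
pose Q (m n : R * R * seq (R * I)) :=
  (m.1.1 * n.1.1 / 2, m.1.2 - n.1.2, m.2 ++ [seq (- p.1, p.2) | p <- n.2]).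
exists ([seq P m n | m <- t, n <- u] ++ [seq Q m n | m <- t, n <- u]) => x.
rewrite ft gu /trig_eval big_cat/= !big_allpairs_dep/= -big_split/= mulr_suml.
apply: eq_bigr => m _; rewrite mulr_sumr -big_split/=.
apply: eq_bigr => n _; rewrite !lin_comb_cat lin_combN.
set a := lin_comb m.2 x; set b := lin_comb n.2 x.
have -> : m.1.2 + n.1.2 + (a + b) = (m.1.2 + a) + (n.1.2 + b) by ring.
have -> : m.1.2 - n.1.2 + (a - b) = (m.1.2 + a) - (n.1.2 + b) by ring.
by rewrite (cosD (m.1.2 + a)) (cosB (m.1.2 + a)); field.
Qed.

End TrigPolynomials.

(** * Integrability of linear combinations of real functions *)

Section RealIntegrable.
Context d (T : measurableType d) (R : realType) (mu : {measure set T -> \bar R}).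
Implicit Types f g : T -> R.

Lemma Rintegrable_scale k f : mu.-integrable setT (EFin \o f) ->
  mu.-integrable setT (EFin \o (fun x => k * f x)).
Proof. exact: (integrableZl measurableT k). Qed.

Lemma Rintegrable_add f g : mu.-integrable setT (EFin \o f) ->
  mu.-integrable setT (EFin \o g) ->
  mu.-integrable setT (EFin \o (fun x => f x + g x)).
Proof. exact: (integrableD measurableT). Qed.

Lemma Rintegrable_sub f g : mu.-integrable setT (EFin \o f) ->
  mu.-integrable setT (EFin \o g) ->
  mu.-integrable setT (EFin \o (fun x => f x - g x)).
Proof. exact: (integrableB measurableT). Qed.

End RealIntegrable.

(** * Integrals against the centered normal density *)

Section GaussianIntegrals.
Context {R : realType}.
Notation mu := (@lebesgue_measure R).

(** Over [[-(n + 1), n + 1]] the integral is a difference of values of [G], which decay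
    quadratically; dominated convergence gives the integral over the line. *)
Lemma integral_derive_eq0 (G g : R -> R) (M : R) :
  (forall x : R, is_derive x 1 G (g x)) -> continuous g ->
  mu.-integrable setT (EFin \o g) -> (forall x, x ^+ 2 * `|G x| <= M) ->
  \int[mu]_x g x = 0.
Proof.
move=> dG cg ig bG.
pose B (n : nat) := `[- n.+1%:R, n.+1%:R : R]%classic.
have mg : measurable_fun setT g by exact: continuous_measurable_fun.
have mB n : measurable (B n) by exact: measurable_itv.
have cG : continuous G.
  move=> x; apply: differentiable_continuous; apply/derivable1_diffP.
  exact: (@ex_derive _ _ _ _ _ _ _ (dG x)).
have intB n : (\int[mu]_(x in B n) (g x)%:E = (G n.+1%:R - G (- n.+1%:R))%:E)%E.
  rewrite (@continuous_FTC2 R g G)//.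
  - by rewrite gtrN// ltr0n.
  - exact: continuous_subspaceT.
  - split.
    + by move=> x _; exact: (@ex_derive _ _ _ _ _ _ _ (dG x)).
    + by apply: cvg_at_right_filter; exact: cG.
    + by apply: cvg_at_left_filter; exact: cG.
  - by move=> x _; rewrite derive1E; exact: (@derive_val _ _ _ _ _ _ _ (dG x)).
have lim1 : (fun n => \int[mu]_(x in B n) (g x)%:E)%E @ \oo -->
    (\int[mu]_x (g x)%:E)%E.
  have h := @dominated_cvg _ _ R mu setT measurableT
    (fun n => (EFin \o g) \_ (B n)) (EFin \o g) (fun x => `|(g x)%:E|%E).
  rewrite (_ : (fun n => _) = fun n => (\int[mu]_(x in setT) ((EFin \o g) \_ (B n)) x)%E).
    apply: h.
    - by move=> n; apply/(measurable_restrictT _ (mB n)); apply: measurable_funTS;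
        exact/measurable_EFinP.
    - move=> x _; apply: cvg_near_cst; near=> n.
      rewrite patchE mem_set// /B/= in_itv/= -ler_norml.
      apply: (@le_trans _ _ n%:R); last by rewrite ler_nat.
      by near: n; exact: nbhs_infty_ger.
    - by move=> x _.
    - exact: integrable_abse.
    - move=> n x _; rewrite patchE; case: ifP => // _.
      by rewrite abse0.
  by apply/funext => n; rewrite integral_mkcond.
have lim0 : (fun n => \int[mu]_(x in B n) (g x)%:E)%E @ \oo --> 0%E.
  rewrite (_ : (fun n => _) = EFin \o (fun n => G n.+1%:R - G (- n.+1%:R))); last first.
    by apply/funext => n; rewrite intB.
  apply: cvg_EFin; first exact: nearW.
  have M0 : 0 <= M by apply: le_trans (bG 0); rewrite expr0n mul0r.
  have b (x : R) n : `|x| = n.+1%:R -> `|G x| <= M * n.+1%:R^-1.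
    move=> xn; rewrite ler_pdivlMr ?ltr0n// mulrC.
    apply: le_trans (bG x); rewrite ler_wpM2r// -real_normK ?num_real// xn.
    by rewrite -natrX ler_nat -[leqLHS]muln1 leq_mul.
  have z (s : R) : `|s| = 1 -> G (s * n.+1%:R) @[n --> \oo] --> (0 : R).
    move=> s1; apply: norm_cvg0.
    apply: (squeeze_cvgr _ (cvg_cst 0) (_ : M * n.+1%:R^-1 @[n --> \oo] --> (0 : R))).
      apply: nearW => n; rewrite normr_ge0/= b//.
      by rewrite normrM s1 mul1r ger0_norm.
    by rewrite -(mulr0 M); apply: cvgMr; exact: cvg_harmonic.
  rewrite -(subr0 0); apply: cvgB.
    by under eq_fun do rewrite -[_.+1%:R]mul1r; apply: z; rewrite normr1.
  by under eq_fun do rewrite -[- _.+1%:R]mulN1r; apply: z; rewrite normrN1.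
have := cvg_unique _ lim1 lim0.
by rewrite /Rintegral => ->.
Unshelve. all: by end_near. Qed.

Section Density.
Variable s : R.
Hypothesis s0 : 0 < s.

Let p := normal_pdf 0 s.
Let c := normal_peak s.

Let s_neq0 : s != 0. Proof. by rewrite gt_eqF. Qed.
Let s2_gt0 : 0 < s ^+ 2. Proof. exact: exprn_gt0. Qed.

Lemma centered_normal_pdfE x : p x = c * expR (- (x ^+ 2 / (2 * s ^+ 2))).
Proof.
rewrite /p normal_pdfE// /normal_fun subr0 mulNr -[_ *+ 2]mulr_natl.
by [].
Qed.

Lemma is_derive_centered_normal_pdf (x : R) : is_derive x 1 p (- (x / s ^+ 2) * p x).
Proof.
have -> : p = (fun x => c * expR (- (x ^+ 2 / (2 * s ^+ 2)))).
  by apply/funext => y; rewrite centered_normal_pdfE.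
by apply: is_derive_eq; rewrite /GRing.scale/=; field.
Qed.

(** Half of the Gaussian exponent absorbs the polynomial; the other half is, up to a constant, a
    normal density of twice the variance, whose multiple is taken as [q]. *)
Lemma normal_pdf_poly_decay : exists q : R -> R,
  [/\ mu.-integrable setT (EFin \o q), exists M, forall x, q x <= M &
      forall x, (1 + x ^+ 2) ^+ 2 * p x <= q x].
Proof.
pose s' := Num.sqrt 2 * s.
have s'0 : s' != 0 by rewrite gt_eqF// mulr_gt0// sqrtr_gt0.
have s'2 : s' ^+ 2 = 2 * s ^+ 2 by rewrite exprMn sqr_sqrtr.
pose a := c * (1 + 8 * s ^+ 2) ^+ 2 / normal_peak s'.
have c0 : 0 <= c by exact: normal_peak_ge0.
have a0 : 0 <= a by rewrite divr_ge0 ?normal_peak_ge0// mulr_ge0 ?sqr_ge0.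
exists (fun x => a * normal_pdf 0 s' x); split.
- by apply: Rintegrable_scale; exact: integrable_normal_pdf.
- exists (a * normal_peak s') => x; rewrite ler_wpM2l//.
  exact: normal_pdf_ub.
- move=> x; rewrite centered_normal_pdfE normal_pdfE// /normal_fun.
  rewrite subr0 s'2 /a [leRHS]mulrA divfK; last first.
    by rewrite gt_eqF// normal_peak_gt0.
  rewrite mulrCA -[leRHS]mulrA ler_wpM2l//.
  (* From [1 + x^2 <= (1 + 8 s^2) (1 + u)] and [1 + u <= expR u] comes the factor [(1 + 8 s^2)^2] in
     [a]. *)
  pose u := x ^+ 2 / (8 * s ^+ 2).
  have u0 : 0 <= u by rewrite divr_ge0 ?sqr_ge0// mulr_ge0// ltW.
  have -> : - (x ^+ 2 / (2 * s ^+ 2)) = - u *+ 2 + - u *+ 2 by rewrite /u; field.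
  have -> : - x ^+ 2 / (2 * s ^+ 2 *+ 2) = - u *+ 2 by rewrite /u; field.
  rewrite expRD mulrA ler_wpM2r ?expR_ge0//.
  rewrite mulr2n expRD -expr2 -exprMn ler_sqr ?nnegrE.
  + rewrite expRN ler_pdivrMr ?expR_gt0//.
    apply: (@le_trans _ _ ((1 + 8 * s ^+ 2) * (1 + u))).
      have -> : x ^+ 2 = u * (8 * s ^+ 2) by rewrite /u; field.
      by nra.
    by rewrite ler_wpM2l ?expR_ge1Dx// addr_ge0// mulr_ge0// ltW.
  + by rewrite mulr_ge0 ?expR_ge0// addr_ge0 ?sqr_ge0.
  + by rewrite addr_ge0// mulr_ge0// ltW.
Qed.

Lemma integrable_poly_normal_pdf (h : R -> R) (C : R) :
  continuous h -> (forall x, `|h x| <= C * (1 + x ^+ 2) ^+ 2) ->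
  mu.-integrable setT (EFin \o (fun x => h x * p x)).
Proof.
move=> ch hC; have [q [iq _ pq]] := normal_pdf_poly_decay.
have p0 x : 0 <= p x by exact: normal_pdf_ge0.
have C0 : 0 <= C.
  have := le_trans (normr_ge0 _) (hC 0).
  by rewrite expr0n/= addr0 expr1n mulr1.
have iCq : mu.-integrable setT (EFin \o (fun x => C * q x)).
  exact: Rintegrable_scale.
apply: le_integrable iCq => //.
  apply/measurable_EFinP; apply: continuous_measurable_fun => x.
  by apply: cvgM; [exact: ch|exact: continuous_normal_pdf].
move=> x _; rewrite /= lee_fin normrM (ger0_norm (p0 x)).
apply: (@le_trans _ _ (C * q x)); last exact: ler_norm.
apply: (@le_trans _ _ (C * (1 + x ^+ 2) ^+ 2 * p x)); first by rewrite ler_wpM2r.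
by rewrite -mulrA ler_wpM2l.
Qed.

(** Stein's identity: [s^2 h' p - x h p] is the derivative of [s^2 h p], and the fast decay of [p]
    makes its integral vanish. *)
Lemma normal_integration_by_parts (h dh : R -> R) (C : R) :
  (forall x : R, is_derive x 1 h (dh x)) -> continuous dh ->
  (forall x, `|h x| <= C * (1 + x ^+ 2)) -> (forall x, `|dh x| <= C * (1 + x ^+ 2)) ->
  \int[mu]_x (x * h x * p x) = s ^+ 2 * \int[mu]_x (dh x * p x).
Proof.
move=> dhE cdh hC dhC.
have ch : continuous h.
  move=> x; apply: differentiable_continuous; apply/derivable1_diffP.
  exact: (@ex_derive _ _ _ _ _ _ _ (dhE x)).
have p0 x : 0 <= p x by exact: normal_pdf_ge0.
have C0 : 0 <= C.
  by have := le_trans (normr_ge0 _) (hC 0); rewrite expr0n/= addr0 mulr1.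
have i1 : mu.-integrable setT (EFin \o (fun x => dh x * p x)).
  apply: (@integrable_poly_normal_pdf _ C) => // x.
  apply: (le_trans (dhC x)); rewrite ler_wpM2l//.
  by have := sqr_ge0 x; nra.
have i2 : mu.-integrable setT (EFin \o (fun x => x * h x * p x)).
  apply: (@integrable_poly_normal_pdf _ C) => [x|x].
    by apply: cvgM; [exact: cvg_id|exact: ch].
  rewrite normrM expr2 mulrA [leRHS]mulrC ler_pM//.
  by rewrite ler_norml; have := sqr_ge0 (x + 1); have := sqr_ge0 (x - 1);
    move=> *; apply/andP; split; nra.
have i3 : mu.-integrable setT (EFin \o (fun x => s ^+ 2 * (dh x * p x))).
  exact: Rintegrable_scale.
apply/eqP; rewrite eq_sym -subr_eq0 -RintegralZl// -RintegralB//; apply/eqP.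
have [q [_ [M qM] pq]] := normal_pdf_poly_decay.
apply: (@integral_derive_eq0 (fun x => s ^+ 2 * (h x * p x)) _ (s ^+ 2 * (C * M))).
- move=> x; have d1 := dhE x; have d2 := is_derive_centered_normal_pdf x.
  by apply: is_derive_eq; rewrite /GRing.scale/=; field.
- move=> x; apply: cvgB; apply: cvgM => //.
  + exact: cvg_cst.
  + by apply: cvgM; [exact: cdh|exact: continuous_normal_pdf].
  + by apply: cvgM; [exact: cvg_id|exact: ch].
  + exact: continuous_normal_pdf.
- exact: Rintegrable_sub.
- move=> x; rewrite normrM (ger0_norm (ltW s2_gt0)) normrM (ger0_norm (p0 x)).
  rewrite mulrCA ler_wpM2l ?(ltW s2_gt0)//.
  apply: (@le_trans _ _ (x ^+ 2 * (C * (1 + x ^+ 2) * p x))).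
    by rewrite ler_wpM2l ?sqr_ge0// ler_wpM2r.
  apply: (@le_trans _ _ (C * ((1 + x ^+ 2) ^+ 2 * p x))); last first.
    by rewrite ler_wpM2l// (le_trans (pq x)).
  rewrite [leLHS](_ : _ = C * (x ^+ 2 * (1 + x ^+ 2) * p x)); last by ring.
  rewrite ler_wpM2l// ler_wpM2r//.
  by have := sqr_ge0 x; nra.
Qed.

Lemma normal_integral_id : \int[mu]_x (x * p x) = 0.
Proof.
have := @normal_integration_by_parts (cst 1) (cst 0) 1.
rewrite /cst; under eq_Rintegral do rewrite mulr1.
move=> ->//.
- under eq_Rintegral do rewrite mul0r.
  by rewrite Rintegral_cst// mul0r mulr0.
- by move=> x; exact: cvg_cst.
- by move=> x; rewrite normr1 mul1r lerDl sqr_ge0.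
- by move=> x; rewrite normr0 mul1r addr_ge0 ?sqr_ge0.
Qed.

Lemma normal_integral_sqr : \int[mu]_x (x ^+ 2 * p x) = s ^+ 2.
Proof.
rewrite -[RHS]mulr1.
have <- : \int[mu]_x (1 * p x) = 1.
  under eq_Rintegral do rewrite mul1r.
  by rewrite /Rintegral integral_normal_pdf.
rewrite -(@normal_integration_by_parts id (cst 1) 1)//.
- by move=> x; exact: cvg_cst.
- move=> x; rewrite mul1r ler_norml.
  by have := sqr_ge0 (x + 1); have := sqr_ge0 (x - 1);
    move=> *; apply/andP; split; nra.
- by move=> x; rewrite /cst normr1 mul1r lerDl sqr_ge0.
Qed.

(** As a function of the frequency [t], the integral [F] satisfies [F' = - s^2 t F], by
    differentiation under the integral and Stein's identity; this determines [F 1] from [F 0]. *)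
Lemma normal_integral_cos (th : R) :
  \int[mu]_x (cos (th + x) * p x) = cos th * expR (- (s ^+ 2 / 2)).
Proof.
pose F t := \int[mu]_x (cos (th + t * x) * p x).
have p0 x : 0 <= p x by exact: normal_pdf_ge0.
have dlin (t x : R) : is_derive x 1 (fun x : R => th + t * x) t.
  by apply: is_derive_eq; rewrite /GRing.scale/=; ring.
have clin (t : R) : continuous (fun x : R => th + t * x).
  move=> x; apply: cvgD; first exact: cvg_cst.
  by apply: cvgM; [exact: cvg_cst|exact: cvg_id].
have dF (t : R) : is_derive t 1 F (- (s ^+ 2 * t) * F t).
  pose f t x := cos (th + t * x) * p x.
  have d1f (u x : R) : is_derive u 1 (f ^~ x) (- x * sin (th + u * x) * p x).
    rewrite /f; apply: is_derive_eq; rewrite /GRing.scale/=; ring.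
  have d1fE u x : partial1of2 f u x = - x * sin (th + u * x) * p x.
    rewrite partial1of2E; exact: (@derive_val _ _ _ _ _ _ _ (d1f u x)).
  have int_f u : mu.-integrable setT (EFin \o f u).
    apply: (@integrable_poly_normal_pdf _ 1) => [x|x].
      by apply: continuous_comp; [exact: clin|exact: continuous_cos].
    rewrite mul1r (le_trans (cos_max _))//.
    by have := sqr_ge0 x; nra.
  have int_G : mu.-integrable setT (EFin \o (fun x => (1 + x ^+ 2) * p x)).
    apply: (@integrable_poly_normal_pdf _ 1) => [x|x].
      apply: cvgD; first exact: cvg_cst.
      exact: exprn_continuous.
    rewrite mul1r ger0_norm; last by rewrite addr_ge0 ?sqr_ge0.
    by have := sqr_ge0 x; nra.
  have G0 x : 0 <= (1 + x ^+ 2) * p x by rewrite mulr_ge0// addr_ge0 ?sqr_ge0.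
  have tI : `]t - 1, t + 1[%classic t by rewrite /= in_itv/=; apply/andP; split; lra.
  have dom u x : `]t - 1, t + 1[%classic u -> setT x ->
      `|partial1of2 f u x| <= (1 + x ^+ 2) * p x.
    move=> _ _; rewrite d1fE normrM (ger0_norm (p0 x)) ler_wpM2r// normrM normrN.
    apply: (@le_trans _ _ (`|x| * 1)); first by rewrite ler_wpM2l// sin_max.
    rewrite mulr1 ler_norml.
    by have := sqr_ge0 (x + 1); have := sqr_ge0 (x - 1);
      move=> *; apply/andP; split; nra.
  have der u x : `]t - 1, t + 1[%classic u -> setT x -> derivable (f ^~ x) u 1.
    by move=> _ _; exact: (@ex_derive _ _ _ _ _ _ _ (d1f u x)).
  have D := @derivable_under_integral R _ _ mu f setT measurableT t (t - 1) (t + 1)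
    tI (fun u _ => int_f u) der _ G0 int_G dom.
  have E := @differentiation_under_integral R _ _ mu f setT measurableT t (t - 1) (t + 1)
    tI (fun u _ => int_f u) der _ G0 int_G dom.
  split; first exact: D.
  rewrite -derive1E E.
  transitivity (- \int[mu]_x (x * sin (th + t * x) * p x)).
    rewrite -mulN1r -RintegralZl//.
      by apply: eq_Rintegral => x _; rewrite d1fE; ring.
    apply: (@integrable_poly_normal_pdf _ 1) => [x|x].
      apply: cvgM; first exact: cvg_id.
      by apply: continuous_comp; [exact: clin|exact: continuous_sin].
    rewrite mul1r normrM (@le_trans _ _ (`|x| * 1))//.
      by rewrite ler_wpM2l// sin_max.
    rewrite mulr1 ler_norml.
    by have := sqr_ge0 (x + 1); have := sqr_ge0 (x - 1); have := sqr_ge0 (x ^+ 2);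
      move=> *; apply/andP; split; nra.
  rewrite (@normal_integration_by_parts (fun x => sin (th + t * x)) (fun x => t * cos (th + t * x))
    (1 + `|t|) _ _ _ _) ?mulNr.
  - congr (- _); rewrite -[RHS]mulrA; congr (_ * _).
    rewrite /F -RintegralZl//; last exact: (int_f t).
    by apply: eq_Rintegral => x _; rewrite mulrA.
  - move=> x; have d := dlin t x; apply: is_derive_eq.
    by rewrite /GRing.scale/=; ring.
  - move=> x; apply: cvgM; first exact: cvg_cst.
    by apply: continuous_comp; [exact: clin|exact: continuous_cos].
  - move=> x; apply: (le_trans (sin_max _)).
    by have := sqr_ge0 x; have := normr_ge0 t; nra.
  - move=> x; rewrite normrM (@le_trans _ _ (`|t| * 1))//.
      by rewrite ler_wpM2l// cos_max.
    by have := sqr_ge0 x; have := normr_ge0 t; nra.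
(* Integrating factor: the differential equation of [F] makes [H] constant. *)
pose H t := F t * expR (s ^+ 2 / 2 * t ^+ 2).
have H10 : H 1 = H 0.
  apply: is_derive_0_is_cst => t.
  have d := dF t; rewrite /H; apply: is_derive_eq.
  by rewrite /GRing.scale/=; field.
have F0 : F 0 = cos th.
  rewrite /F; under eq_Rintegral do rewrite mul0r addr0.
  rewrite RintegralZl//; last exact: integrable_normal_pdf.
  by rewrite /Rintegral integral_normal_pdf mulr1.
have F1 : F 1 = \int[mu]_x (cos (th + x) * p x).
  by apply: eq_Rintegral => x _; rewrite mul1r.
move: H10; rewrite /H F0 F1 expr1n mulr1 expr0n/= mulr0 expR0 mulr1 => <-.
by rewrite -mulrA -expRD addrN expR0 mulr1.
Qed.

End Density.
End GaussianIntegrals.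

(** * Moments and characteristic functions of centered Gaussian variables *)

Section GaussianExpectation.
Context d (T : measurableType d) (R : realType) (P : probability T R).
Notation mu := (@lebesgue_measure R).

(** The Radon-Nikodym derivative and [normal_pdf] have the same integral over every measurable set,
    hence agree almost everywhere. *)
Lemma integral_normal_prob (s : R) (f : R -> \bar R) : s != 0 ->
  (normal_prob 0 s).-integrable setT f ->
  (\int[normal_prob 0 s]_x f x = \int[mu]_x (f x * (normal_pdf 0 s x)%:E))%E.
Proof.
move=> s0 fi; have dom := @normal_prob_dominates R 0 s.
have mf := measurable_int _ fi.
have mp : measurable_fun setT (EFin \o normal_pdf 0 s).
  by apply/measurable_EFinP; exact: measurable_normal_pdf.
rewrite -(Radon_Nikodym_change_of_variables dom)//.
apply: ae_eq_integral => //.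
- exact: emeasurable_funM.
- exact: emeasurable_funM.
apply: ae_eqe_mul2l.
apply: integral_ae_eq => //; first exact: Radon_Nikodym_integrable.
by move=> E _ mE; rewrite -Radon_Nikodym_integral.
Qed.

(* Generic in the codomain because [R] and [measurableTypeR R], on which
   [normal_prob] lives, have the same measurable sets but different displays. *)
Lemma same_law_integral d' (U : measurableType d') (X : T -> U)
    (nu : {measure set U -> \bar R}) (h : U -> R) :
  measurable_fun setT X ->
  (forall A, measurable A -> pushforward P X A = nu A) ->
  measurable_fun setT h -> P.-integrable setT (EFin \o (h \o X)) ->
  nu.-integrable setT (EFin \o h) /\
  (\int[P]_w (h (X w))%:E = \int[nu]_x (h x)%:E)%E.
Proof.
move=> mX lX mh ih.
have mh' : measurable_fun setT (EFin \o h) by exact/measurable_EFinP.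
have E (f : U -> \bar R) : (\int[pushforward P X]_x f x = \int[nu]_x f x)%E.
  by apply: eq_measure_integral => A mA _; exact: lX.
split; last by rewrite -E integral_pushforward.
have := integrable_pushforward mX mh' ih measurableT.
by move=> /integrableP[_ fin]; apply/integrableP; split => //; rewrite -E.
Qed.

Lemma bounded_integrable (f : T -> R) (C : R) : measurable_fun setT f ->
  (forall w, `|f w| <= C) -> P.-integrable setT (EFin \o f).
Proof.
move=> mf fC; apply: measurable_bounded_integrable => //.
  by apply: (le_lt_trans (probability_le1 P measurableT)); rewrite ltry.
by exists C; split; [exact: num_real|move=> y Cy w _; exact: le_trans (ltW Cy)].
Qed.

Lemma L2_measurable (X : L2 P) : measurable_fun setT (X : T -> R).
Proof. exact: measurable_funPT. Qed.

Lemma L2_integrable (X : L2 P) : P.-integrable setT (EFin \o (X : T -> R)).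
Proof.
apply/Lfun1_integrable.
by apply: (@Lfun_subset12 _ _ _ P (fin_num_measure P _ measurableT)); exact: LfunP.
Qed.

Lemma L2_mul_integrable (X Y : L2 P) :
  P.-integrable setT (EFin \o (fun w => X w * Y w)).
Proof. by apply/Lfun1_integrable; apply: Lfun2_mul_Lfun1; exact: LfunP. Qed.

(** With the variance written as a second moment, one formula covers the point mass at 0 and the
    nondegenerate normal laws. *)
Lemma centered_gaussian_moments (X : L2 P) : centered_gaussian P X ->
  \int[P]_w X w = 0 /\
  forall th, \int[P]_w cos (th + X w) =
    cos th * expR (- (\int[P]_w (X w * X w) / 2)).
Proof.
have mX := L2_measurable X.
have iX := L2_integrable X.
have iXX := L2_mul_integrable X X.
have mcos th : measurable_fun setT (fun x : R => cos (th + x)).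
  apply: continuous_measurable_fun => x.
  by apply: continuous_comp; [apply: cvgD; [exact: cvg_cst|exact: cvg_id]|
    exact: continuous_cos].
have icos th : P.-integrable setT (EFin \o ((fun x : R => cos (th + x)) \o X)).
  apply: (@bounded_integrable _ 1) => [|w]; last exact: cos_max.
  exact: measurableT_comp.
have msqr : measurable_fun setT (fun x : R => x * x) by exact: measurable_funM.
move=> [lX|[s s0 lX]].
- have L h : measurable_fun setT h -> P.-integrable setT (EFin \o (h \o X)) ->
      \int[P]_w h (X w) = h 0.
    move=> mh ih; have [_] := @same_law_integral _ R X (\d_(0 : R)) h mX lX mh ih.
    rewrite integral_dirac//; last exact/measurable_EFinP.
    by rewrite diracT mul1e /Rintegral => ->.
  split=> [|th]; first exact: (L id).
  rewrite (L (fun x => cos (th + x)))// (L (fun x => x * x))//.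
  by rewrite mul0r mul0r oppr0 expR0 addr0 mulr1.
- have L h : measurable_fun setT h -> P.-integrable setT (EFin \o (h \o X)) ->
      \int[P]_w h (X w) = \int[mu]_x (h x * normal_pdf 0 s x).
    move=> mh ih; have [ih' E] :=
      @same_law_integral _ (measurableTypeR R) X (normal_prob 0 s) h mX lX mh ih.
    by rewrite /Rintegral E integral_normal_prob// gt_eqF.
  split=> [|th]; first by rewrite (L id)// normal_integral_id.
  rewrite (L (fun x => cos (th + x)))// (L (fun x => x * x))//.
  rewrite normal_integral_cos//.
  by under eq_Rintegral do rewrite -expr2; rewrite normal_integral_sqr.
Qed.

End GaussianExpectation.

(** * Representation of finitely many Gaussian variables by walks *)

Section GaussianTrigInequality.
Context d (T : measurableType d) (R : realType) (P : probability T R).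
Implicit Types (X Y Z : L2 P) (G : set (L2 P)).

(** Only a semi-inner product, as elements of [L2] are functions rather than classes. *)
Definition inner X Y : R := \int[P]_w (X w * Y w).

Lemma innerC X Y : inner X Y = inner Y X.
Proof. by apply: eq_Rintegral => w _; rewrite mulrC. Qed.

Lemma innerDl X Y Z : inner (X + Y) Z = inner X Z + inner Y Z.
Proof.
rewrite /inner -RintegralD//; [|exact: L2_mul_integrable..].
by apply: eq_Rintegral => w _; rewrite -mulrDl.
Qed.

Lemma innerZl c X Y : inner (c *: X) Y = c * inner X Y.
Proof.
rewrite /inner -RintegralZl//; last exact: L2_mul_integrable.
by apply: eq_Rintegral => w _; rewrite mulrA.
Qed.

Lemma inner0l Y : inner 0 Y = 0.
Proof. by rewrite -(scale0r 0) innerZl mul0r. Qed.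

Lemma inner_ge0 X : 0 <= inner X X.
Proof. by apply: Rintegral_ge0 => w _; rewrite -expr2 sqr_ge0. Qed.

Lemma inner_suml (I : Type) (s : seq I) (F : I -> L2 P) Y :
  inner (\sum_(i <- s) F i) Y = \sum_(i <- s) inner (F i) Y.
Proof.
elim: s => [|i s ih]; first by rewrite !big_nil inner0l.
by rewrite !big_cons innerDl ih.
Qed.

Lemma inner_sum2 (I J : Type) (s : seq I) (t : seq J) (F : I -> L2 P) (K : J -> L2 P) :
  inner (\sum_(i <- s) F i) (\sum_(j <- t) K j) =
  \sum_(i <- s) \sum_(j <- t) inner (F i) (K j).
Proof.
rewrite inner_suml; apply: eq_bigr => i _.
by rewrite innerC inner_suml; apply: eq_bigr => j _; rewrite innerC.
Qed.

Lemma closed_subspace_sum G (I : Type) (s : seq I) (F : I -> L2 P) :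
  closed_subspace G -> (forall i, G (F i)) -> G (\sum_(i <- s) F i).
Proof.
move=> [[G0 GL] _] GF; elim: s => [|i s ih].
  by rewrite big_nil; exact/set_mem.
rewrite big_cons -[F i]scale1r; apply/set_mem/GL; exact/mem_set.
Qed.

Lemma closed_subspaceZ G c X : closed_subspace G -> G X -> G (c *: X).
Proof.
move=> [[G0 GL] _] GX; rewrite -[c *: X]addr0; apply/set_mem/GL => //.
exact/mem_set.
Qed.

Lemma closed_subspaceD G X Y : closed_subspace G -> G X -> G Y -> G (X + Y).
Proof.
move=> [[G0 GL] _] GX GY; rewrite -[X]scale1r.
by apply/set_mem/GL; exact/mem_set.
Qed.

(** The valuation of the variables indexed by [G] that a sample point [w] defines. *)
Definition eval_at G (w : T) (i : set_type G) : R := (val i : L2 P) w.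

Definition comb G (s : seq (R * set_type G)) : L2 P := \sum_(p <- s) p.1 *: val p.2.

Lemma combE G (s : seq (R * set_type G)) w : comb s w = lin_comb s (@eval_at G w).
Proof.
rewrite /comb /lin_comb; elim: s => [|p s ih]; first by rewrite !big_nil.
by rewrite !big_cons -ih.
Qed.

Lemma comb_in G (s : seq (R * set_type G)) : closed_subspace G -> G (comb s).
Proof.
move=> cG; apply: closed_subspace_sum => // p.
by apply: closed_subspaceZ => //; exact: set_valP.
Qed.

Lemma inner_comb G G' (s : seq (R * set_type G)) (t : seq (R * set_type G')) :
  inner (comb s) (comb t) =
  \sum_(p <- s) \sum_(q <- t) p.1 * q.1 * inner (val p.2) (val q.2).
Proof.
rewrite /comb inner_sum2; apply: eq_bigr => p _; apply: eq_bigr => q _.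
by rewrite innerZl innerC innerZl innerC mulrA.
Qed.

Section Walk.
Variables (H H1 H2 : set (L2 P)).
Hypothesis gH : gaussian_hilbert_space H.
Hypothesis (cH1 : closed_subspace H1) (cH2 : closed_subspace H2).
Hypothesis (H1H : H1 `<=` H) (H2H : H2 `<=` H).
Variable r : R.
Hypothesis r01 : 0 <= r <= 1.
Hypothesis corr : forall X Y, H1 X -> H2 Y ->
  `|inner X Y| <= r * (Num.sqrt (inner X X) * Num.sqrt (inner Y Y)).

(* Gram matrix of vectors representing [H1] and [H2] isometrically, with the
   cross terms divided by [r]; for [r = 0] these vanish, as [x / 0 = 0]. *)
Definition gram_kernel (i j : set_type H1 + set_type H2) : R :=
  match i, j with
  | inl x, inl y => inner (val x) (val y)
  | inl x, inr y => inner (val x) (val y) / r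
  | inr x, inl y => inner (val x) (val y) / r
  | inr x, inr y => inner (val x) (val y)
  end.

Lemma gram_kernelC i j : gram_kernel i j = gram_kernel j i.
Proof. by case: i; case: j => *; rewrite /= innerC. Qed.

(** For the [H1]-part [A] and the [H2]-part [B] of the combination the form is
    [|A|^2 + |B|^2 + 2 <A, B> / r], which is at least [(|A| - |B|)^2] by the correlation bound. *)
Lemma gram_kernel_psd s : 0 <= quad_form gram_kernel s.
Proof.
pose u (p : R * (set_type H1 + set_type H2)) : L2 P :=
  if p.2 is inl x then p.1 *: val x else 0.
pose v (p : R * (set_type H1 + set_type H2)) : L2 P :=
  if p.2 is inr x then p.1 *: val x else 0.
have G0 (G : set (L2 P)) : closed_subspace G -> G 0.
  by move=> [[G0 _] _]; exact/set_mem.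
have uH p : H1 (u p).
  rewrite /u; case: p.2 => x; last exact: G0.
  by apply: closed_subspaceZ => //; exact: set_valP.
have vH p : H2 (v p).
  rewrite /v; case: p.2 => x; first exact: G0.
  by apply: closed_subspaceZ => //; exact: set_valP.
pose A := \sum_(p <- s) u p; pose B := \sum_(p <- s) v p.
have AH : H1 A by exact: closed_subspace_sum.
have BH : H2 B by exact: closed_subspace_sum.
have -> : quad_form gram_kernel s = inner A A + inner B B + 2 * (inner A B / r).
  have -> : inner A A + inner B B + 2 * (inner A B / r) =
     inner A A + inner A B / r + (inner B A / r + inner B B).
    by rewrite (innerC B A); ring.
  rewrite !inner_sum2 !mulr_suml -!big_split/=; apply: eq_bigr => p _.
  rewrite !mulr_suml -!big_split/=; apply: eq_bigr => q _.
  case: p => a [x|x]; case: q => b [y|y]; rewrite /u /v/= ?inner0l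
    ?(innerC _ 0) ?inner0l ?innerZl ?(innerC _ (b *: _)) ?innerZl;
    rewrite ?(innerC (val y)); ring.
have [r0 r1] := andP r01.
set a := Num.sqrt (inner A A); set b := Num.sqrt (inner B B).
have -> : inner A A = a ^+ 2 by rewrite sqr_sqrtr ?inner_ge0.
have -> : inner B B = b ^+ 2 by rewrite sqr_sqrtr ?inner_ge0.
have : `|inner A B / r| <= a * b.
  have [->|rn0] := eqVneq r 0.
    by rewrite invr0 mulr0 normr0 mulr_ge0 ?sqrtr_ge0.
  have r_gt0 : 0 < r by rewrite lt_neqAle eq_sym rn0.
  by rewrite normrM normfV (ger0_norm r0) ler_pdivrMr// mulrC corr.
rewrite ler_norml => /andP[h _].
by have := sqr_ge0 (a - b); nra.
Qed.

Let V1 := set_type H1 -> R.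
Let V2 := set_type H2 -> R.

(** Each coordinate of the Gram vectors becomes one step. The weight [r] in [cov_form] undoes the
    division by [r] in [gram_kernel], so the walk has the covariances of the Gaussian variables. *)
Lemma gram_walk (S1 : seq (set_type H1)) (S2 : seq (set_type H2)) :
  exists l : seq (V1 * V2), forall s t,
    {subset map snd s <= S1} -> {subset map snd t <= S2} ->
    \sum_(ab <- l) cov_form r (lin_comb s ab.1) (lin_comb t ab.2) =
    inner (comb s + comb t) (comb s + comb t).
Proof.
have [L LE] := gram_factorization (map inl S1 ++ map inr S2)
  gram_kernelC gram_kernel_psd.
exists [seq (c \o inl, c \o inr) | c <- L] => s t sS tS.
have expand (I J : eqType) (u : seq (R * I)) (v : seq (R * J))
    (f : I -> set_type H1 + set_type H2) (g : J -> set_type H1 + set_type H2) :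
    (forall i, i \in map snd u -> f i \in map inl S1 ++ map inr S2) ->
    (forall j, j \in map snd v -> g j \in map inl S1 ++ map inr S2) ->
    \sum_(c <- L) lin_comb u (c \o f) * lin_comb v (c \o g) =
    \sum_(p <- u) \sum_(q <- v) p.1 * q.1 * gram_kernel (f p.2) (g q.2).
  move=> fS gS.
  under eq_bigr do rewrite /lin_comb mulr_suml.
  rewrite exchange_big/=; apply: eq_big_seq => p pu.
  under eq_bigr do rewrite mulr_sumr.
  rewrite exchange_big/=; apply: eq_big_seq => q qv.
  rewrite -LE; [|by apply: fS; exact: map_f|by apply: gS; exact: map_f].
  by rewrite mulr_sumr; apply: eq_bigr => c _; ring.
have inS1 i : i \in map snd s ->
    (inl i : set_type H1 + set_type H2) \in map inl S1 ++ map inr S2.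
  by move=> /sS iS; rewrite mem_cat map_f.
have inS2 i : i \in map snd t ->
    (inr i : set_type H1 + set_type H2) \in map inl S1 ++ map inr S2.
  by move=> /tS iS; rewrite mem_cat map_f ?orbT.
rewrite big_map/= /cov_form.
under eq_bigr do rewrite !expr2.
rewrite !big_split/= -mulr_sumr.
rewrite (expand _ _ s s inl inl)// (expand _ _ t t inr inr)// (expand _ _ s t inl inr)//=.
have -> : inner (comb s + comb t) (comb s + comb t) =
    inner (comb s) (comb s) + inner (comb t) (comb t) + 2 * inner (comb s) (comb t).
  by rewrite innerDl (innerC (comb s)) (innerC (comb t)) !innerDl
    (innerC (comb t) (comb s)); ring.
rewrite -!inner_comb; congr (_ + _).
have -> : \sum_(p <- s) \sum_(q <- t) p.1 * q.1 * (inner (val p.2) (val q.2) / r) =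
    inner (comb s) (comb t) / r.
  rewrite inner_comb mulr_suml; apply: eq_bigr => p _.
  by rewrite mulr_suml; apply: eq_bigr => q _; rewrite mulrA.
(* For [r = 0] the division cannot be undone, but [corr] forces the cross term to vanish. *)
have [r0|rn0] := eqVneq r 0; last by field.
have := corr (comb_in s cH1) (comb_in t cH2).
by rewrite r0 mul0r normr_le0 => /eqP ->; rewrite mul0r !mulr0.
Qed.

Lemma integrable_cos_comb (th : R) s t : P.-integrable setT (EFin \o (fun w =>
  cos (th + lin_comb s (@eval_at H1 w) + lin_comb t (@eval_at H2 w)))).
Proof.
apply: (@bounded_integrable _ _ _ _ _ 1) => [|w]; last exact: cos_max.
apply: (measurableT_comp (f := cos)).
  by apply: continuous_measurable_fun; exact: continuous_cos.
under eq_fun do rewrite -!combE.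
by apply: measurable_funD; [apply: measurable_funD => //|]; exact: L2_measurable.
Qed.

(** Convergence in law tested on one function; integrability is included so that limits can be
    added. *)
Definition walk_cvg (l : seq (V1 * V2)) (F : V1 -> V2 -> R) : Prop :=
  P.-integrable setT (EFin \o (fun w => F (@eval_at H1 w) (@eval_at H2 w))) /\
  walk2 r (rescaled_walk l n) F 0 0 @[n --> \oo] -->
    \int[P]_w F (@eval_at H1 w) (@eval_at H2 w).

Lemma eq_walk_cvg (l : seq (V1 * V2)) F F' :
  (forall x y, F x y = F' x y) -> walk_cvg l F -> walk_cvg l F'.
Proof.
move=> FF'; suff -> : F = F' by [].
by apply/funext => x; apply/funext => y.
Qed.

Lemma walk_cvg_sum (l : seq (V1 * V2)) (I : eqType) (s : seq I) F :
  (forall i, i \in s -> walk_cvg l (F i)) ->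
  walk_cvg l (fun x y => \sum_(i <- s) F i x y).
Proof.
elim: s => [|i s ih] Fs.
  split.
    apply: (eq_integrable measurableT (cst 0%E)) => [w _|]; last exact: integrable0.
    by rewrite /= big_nil.
  under eq_Rintegral do rewrite big_nil.
  rewrite Rintegral_cst// mul0r.
  rewrite (_ : (fun n : nat => _) = cst 0); first exact: cvg_cst.
  apply/funext => n; rewrite -[RHS](mul0r (walk2 r (rescaled_walk l n) (fun _ _ => 0) 0 0)).
  by rewrite -walk2Z; apply: eq_walk2 => x y; rewrite big_nil mul0r.
have [i1 c1] := Fs i (mem_head _ _).
have [i2 c2] : walk_cvg l (fun x y => \sum_(i <- s) F i x y).
  by apply: ih => j js; apply: Fs; rewrite inE js orbT.
split.
  under eq_fun do rewrite big_cons.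
  exact: Rintegrable_add.
under eq_Rintegral do rewrite big_cons.
rewrite RintegralD//.
rewrite (_ : (fun n : nat => _) = fun n => walk2 r (rescaled_walk l n) (F i) 0 0 +
  walk2 r (rescaled_walk l n) (fun x y => \sum_(i <- s) F i x y) 0 0).
  exact: cvgD.
by apply/funext => n; rewrite -walk2D; apply: eq_walk2 => x y; rewrite big_cons.
Qed.

Lemma walk_cvgZ (l : seq (V1 * V2)) c F :
  walk_cvg l F -> walk_cvg l (fun x y => c * F x y).
Proof.
move=> [iF cF]; split; first exact: Rintegrable_scale.
rewrite RintegralZl//; under eq_fun do rewrite walk2Z.
exact: cvgMr.
Qed.

(** A single walk has to serve all three functions, so it is built from all variables of [t] and
    [u]. Every cosine term converges because its limit depends only on the covariances. *)
Lemma walk_cvg_trig_mul (t : seq (R * R * seq (R * set_type H1)))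
    (u : seq (R * R * seq (R * set_type H2))) :
  exists l : seq (V1 * V2),
  [/\ walk_cvg l (fun x y => trig_eval t x * trig_eval u y),
      walk_cvg l (fun x _ => trig_eval t x) & walk_cvg l (fun _ y => trig_eval u y)].
Proof.
have [l hl] := gram_walk (flatten [seq map snd m.2 | m <- t])
  (flatten [seq map snd m.2 | m <- u]).
have cos_cvg th s s' : {subset map snd s <= flatten [seq map snd m.2 | m <- t]} ->
    {subset map snd s' <= flatten [seq map snd m.2 | m <- u]} ->
    walk_cvg l (fun x y => cos (th + lin_comb s x + lin_comb s' y)).
  move=> hs hs'; split; first exact: integrable_cos_comb.
  (* The common Gaussian space enters here: a sum of elements of [H1] and [H2] lies in [H], so its
     characteristic function is known. *)
  have HZ : H (comb s + comb s').
    apply: closed_subspaceD; first exact: gH.1.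
      by apply: H1H; exact: comb_in.
    by apply: H2H; exact: comb_in.
  have [_ mom] := centered_gaussian_moments (gH.2 _ HZ).
  under eq_Rintegral do rewrite -!combE -addrA.
  have -> : \int[P]_w cos (th + (comb s w + comb s' w)) =
      cos th * expR (- (\sum_(ab <- l) cov_form r (lin_comb s ab.1) (lin_comb s' ab.2) / 2)).
    by rewrite -mulr_suml hl// -mom.
  apply: rescaled_walk_cos_cvg => // c x y; exact: lin_comb_linear.
have tS m : m \in t -> {subset map snd m.2 <= flatten [seq map snd m.2 | m <- t]}.
  by move=> mt p pm; apply/flatten_mapP; exists m.
have uS m : m \in u -> {subset map snd m.2 <= flatten [seq map snd m.2 | m <- u]}.
  by move=> mt p pm; apply/flatten_mapP; exists m.
exists l; split.
(* Product-to-sum formula, with [e = 1] for the sum of the arguments and [e = -1] for their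
   difference. *)
- apply: (@eq_walk_cvg l (fun x y => \sum_(m <- t) \sum_(n <- u)
      \sum_(e <- [:: 1; -1]) m.1.1 * n.1.1 / 2 * cos (m.1.2 + e * n.1.2 +
        lin_comb m.2 x + lin_comb [seq (e * p.1, p.2) | p <- n.2] y))).
    move=> x y; rewrite [RHS]mulr_suml; apply: eq_bigr => m _.
    rewrite mulr_sumr; apply: eq_bigr => n _.
    set a := lin_comb m.2 x; set b := lin_comb n.2 y.
    have bE e : lin_comb [seq (e * p.1, p.2) | p <- n.2] y = e * b.
      rewrite /b /lin_comb big_map mulr_sumr.
      by apply: eq_bigr => p _; rewrite mulrA.
    rewrite !big_cons big_nil addr0 !bE !mul1r !mulN1r.
    have -> : m.1.2 + n.1.2 + a + b = (m.1.2 + a) + (n.1.2 + b) by ring.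
    have -> : m.1.2 - n.1.2 + a - b = (m.1.2 + a) - (n.1.2 + b) by ring.
    by rewrite (cosD (m.1.2 + a)) (cosB (m.1.2 + a)); field.
  apply: walk_cvg_sum => m mt; apply: walk_cvg_sum => n nu.
  apply: walk_cvg_sum => e _; apply: walk_cvgZ; apply: cos_cvg; first exact: tS.
  by move=> p; rewrite -map_comp => pn; apply: (uS _ nu).
- apply: walk_cvg_sum => m mt; apply: walk_cvgZ.
  apply: (@eq_walk_cvg l (fun x y => cos (m.1.2 + lin_comb m.2 x + lin_comb [::] y))).
    by move=> x y; rewrite /lin_comb big_nil addr0.
  by apply: cos_cvg => //; exact: tS.
- apply: walk_cvg_sum => m mt; apply: walk_cvgZ.
  apply: (@eq_walk_cvg l (fun x y => cos (m.1.2 + lin_comb [::] x + lin_comb m.2 y))).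
    by move=> x y; rewrite /lin_comb big_nil addr0.
  by apply: cos_cvg => //; exact: uS.
Qed.

End Walk.
End GaussianTrigInequality.

(** * Passage to the Gaussian limit and approximable functions *)

Section Approximation.
Context d (T : measurableType d) (R : realType) (P : probability T R).

(** Right continuity of [y^c], also at [y = 0]. The errors are those of [sigma_correlation]: [2 e]
    for a product of two indicators, and [3 e >= 2 e + e^2] for a product of two probabilities. *)
Lemma powR_le_limit (x y c : R) : 0 <= y -> 0 < c ->
  (forall e, 0 < e <= 1 -> x <= 2 * e + (y + 3 * e) `^ c) -> x <= y `^ c.
Proof.
move=> y0 c0 h; rewrite leNgt; apply/negP => xy.
(* The midpoint leaves room for both errors: [z < x], and the root [z^(1/c)] exceeds [y]. *)
pose z := (x + y `^ c) / 2.
have yc0 : 0 <= y `^ c by exact: powR_ge0.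
have z1 : y `^ c < z by rewrite /z; lra.
have z2 : z < x by rewrite /z; lra.
have zK : (z `^ c^-1) `^ c = z by rewrite -powRrM mulVf ?gt_eqF// powRr1//; lra.
have yz : y < z `^ c^-1.
  rewrite ltNge; apply/negP => zy.
  have : (z `^ c^-1) `^ c <= y `^ c.
    by apply: ge0_ler_powR; rewrite ?nnegrE ?powR_ge0// ltW.
  by rewrite zK; lra.
pose e := Num.min 1 (Num.min ((x - z) / 4) ((z `^ c^-1 - y) / 3)).
have e0 : 0 < e by rewrite !lt_min ltr01/=; apply/andP; split; lra.
have e1 : e <= 1 by rewrite ge_min lexx.
have e2 : e <= (x - z) / 4 by rewrite !ge_min lexx !orbT.
have e3 : e <= (z `^ c^-1 - y) / 3 by rewrite !ge_min lexx !orbT.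
have : (y + 3 * e) `^ c <= z.
  rewrite -zK; apply: ge0_ler_powR; rewrite ?nnegrE ?powR_ge0//; lra.
have := h e; rewrite e0 e1 => /(_ isT); lra.
Qed.

(** [walk2_le] holds for every rescaled walk, and the three expectations in it converge to the
    Gaussian ones. *)
Lemma trig_hypercontractive (H H1 H2 : set (L2 P)) (r : R)
    (f : (set_type H1 -> R) -> R) (g : (set_type H2 -> R) -> R) :
  gaussian_hilbert_space H -> closed_subspace H1 -> closed_subspace H2 ->
  H1 `<=` H -> H2 `<=` H -> 0 <= r <= 1 ->
  (forall X Y, H1 X -> H2 Y ->
    `|inner X Y| <= r * (Num.sqrt (inner X X) * Num.sqrt (inner Y Y))) ->
  trig_poly f -> trig_poly g ->
  (forall x, 0 <= f x <= 1) -> (forall y, 0 <= g y <= 1) ->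
  \int[P]_w (f (@eval_at _ _ _ P H1 w) * g (@eval_at _ _ _ P H2 w)) <=
  ((\int[P]_w f (@eval_at _ _ _ P H1 w)) * (\int[P]_w g (@eval_at _ _ _ P H2 w)))
    `^ (1 + r)^-1.
Proof.
move=> gH cH1 cH2 H1H H2H r01 corr [t ft] [u gu] f01 g01.
have -> : f = trig_eval t by apply/funext.
have -> : g = trig_eval u by apply/funext.
have [l [[_ cfg] [_ cf] [_ cg]]] :=
  walk_cvg_trig_mul gH cH1 cH2 H1H H2H r01 corr t u.
have [r0 r1] := andP r01.
pose Et := \int[P]_w trig_eval t (@eval_at _ _ _ P H1 w).
pose Eu := \int[P]_w trig_eval u (@eval_at _ _ _ P H2 w).
have a0 : 0 <= Et.
  by apply: Rintegral_ge0 => w _; rewrite -ft; case/andP: (f01 (eval_at w)).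
have b0 : 0 <= Eu.
  by apply: Rintegral_ge0 => w _; rewrite -gu; case/andP: (g01 (eval_at w)).
have cc0 : 0 < (1 + r)^-1 by rewrite invr_gt0; lra.
apply: powR_le_limit => [||e /andP[e0 e1]]; [exact: mulr_ge0|exact: cc0|].
rewrite -/Et -/Eu; pose ab := Et * Eu; rewrite -/ab.
have ab0 : 0 <= ab by exact: mulr_ge0.
apply: (@le_trans _ _ ((ab + 3 * e) `^ (1 + r)^-1)); last by rewrite lerDr; lra.
rewrite -(cvg_lim _ cfg)//; apply: limr_le; first by apply/cvg_ex; eexists; exact: cfg.
near=> n.
have h : walk (map fst (rescaled_walk l n)) (trig_eval t) 0 *
    walk (map snd (rescaled_walk l n)) (trig_eval u) 0 <= ab + 3 * e.
  apply: ltW; near: n.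
  have : \forall n \near \oo, walk2 r (rescaled_walk l n) (fun x _ => trig_eval t x) 0 0 *
      walk2 r (rescaled_walk l n) (fun _ y => trig_eval u y) 0 0 < ab + 3 * e.
    by apply: (cvgr_lt (Et * Eu) (cvgM cf cg)); rewrite /ab; lra.
  by apply: filterS => n; rewrite walk2_fst walk2_snd.
apply: le_trans (walk2_le _ r01 _ _ _ _) _.
- by move=> x; rewrite -ft.
- by move=> x; rewrite -gu.
apply: ge0_ler_powR => //; rewrite ?nnegrE.
- exact: ltW.
- by rewrite mulr_ge0// walk_ge0// => x; rewrite -?ft -?gu;
    [case/andP: (f01 x)|case/andP: (g01 x)].
- by rewrite addr_ge0// mulr_ge0// ltW.
Unshelve. all: by end_near. Qed.

Section Class.
Variable G : set (L2 P).
Implicit Types (h k : T -> R) (f : (set_type G -> R) -> R).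

Let ev := @eval_at _ _ _ P G.

Lemma measurable_trig_poly f : trig_poly f -> measurable_fun setT (fun w => f (ev w)).
Proof.
move=> [t ft]; under eq_fun do rewrite ft.
apply: measurable_sum => m; apply: measurable_funM => //.
apply: (measurableT_comp (f := cos)).
  by apply: continuous_measurable_fun; exact: continuous_cos.
by under eq_fun do rewrite -combE; apply: measurable_funD => //; exact: L2_measurable.
Qed.

(* The bounds on [f] are required at every valuation of its variables, not only
   at those given by points of [T]: the sign walks visit other ones. *)
Definition trig_approx h : Prop :=
  [/\ measurable_fun setT h, forall w, 0 <= h w <= 1 &
   forall e, 0 < e -> exists f, [/\ trig_poly f, forall x, 0 <= f x <= 1 &
     \int[P]_w `|h w - f (ev w)| <= e]].

Lemma unit_integrable h : measurable_fun setT h -> (forall w, 0 <= h w <= 1) ->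
  P.-integrable setT (EFin \o h).
Proof.
move=> mh h01; apply: (@bounded_integrable _ _ _ _ _ 1) => // w.
by have /andP[h0 h1] := h01 w; rewrite ger0_norm.
Qed.

Lemma dist_integrable h k : P.-integrable setT (EFin \o h) ->
  P.-integrable setT (EFin \o k) ->
  P.-integrable setT (EFin \o (fun w => `|h w - k w|)).
Proof. by move=> ih ik; apply: integrable_norm; exact: Rintegrable_sub. Qed.

Lemma trig_approx_trig f : trig_poly f -> (forall x, 0 <= f x <= 1) ->
  trig_approx (fun w => f (ev w)).
Proof.
move=> tf f01; split=> [|//|e e0]; first exact: measurable_trig_poly.
exists f; split=> //.
under eq_Rintegral do rewrite subrr normr0.
by rewrite Rintegral_cst// mul0r ltW.
Qed.

Lemma trig_approx_compl h : trig_approx h -> trig_approx (fun w => 1 - h w).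
Proof.
move=> [mh h01 ah]; split=> [|w|e e0].
- exact: measurable_funB.
- by have /andP[h0 h1] := h01 w; apply/andP; split; lra.
- have [f [tf f01 hf]] := ah e e0.
  exists (fun x => 1 + (-1) * f x); split.
  + by apply: trig_polyD; [exact: trig_poly_cst|exact: trig_polyZ].
  + by move=> x; have /andP[h0 h1] := f01 x; apply/andP; split; lra.
  + apply: le_trans hf; rewrite le_eqVlt; apply/orP; left; apply/eqP.
    apply: eq_Rintegral => w _.
    rewrite -normrN; congr `|_|; ring.
Qed.

(** For values in [0, 1] one has [|h k - f g| <= |h - f| + |k - g|]. *)
Lemma trig_approx_mul h k : trig_approx h -> trig_approx k ->
  trig_approx (fun w => h w * k w).
Proof.
move=> [mh h01 ah] [mk k01 ak]; split=> [|w|e e0].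
- exact: measurable_funM.
- by have /andP[h0 h1] := h01 w; have /andP[k0 k1] := k01 w; apply/andP; split; nra.
have e2 : 0 < e / 2 by rewrite divr_gt0.
have [f [tf f01 hf]] := ah _ e2; have [g [tg g01 kg]] := ak _ e2.
have ih := unit_integrable mh h01; have ik := unit_integrable mk k01.
have if_ := unit_integrable (measurable_trig_poly tf) (fun w => f01 (ev w)).
have ig := unit_integrable (measurable_trig_poly tg) (fun w => g01 (ev w)).
exists (fun x => f x * g x); split; first exact: trig_polyM.
  by move=> x; have /andP[h0 h1] := f01 x; have /andP[k0 k1] := g01 x;
    apply/andP; split; nra.
apply: (@le_trans _ _ (\int[P]_w (`|h w - f (ev w)| + `|k w - g (ev w)|))).
  apply: le_Rintegral => //.
  - apply: dist_integrable; apply: unit_integrable.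
    + exact: measurable_funM.
    + by move=> w; have /andP[h0 h1] := h01 w; have /andP[k0 k1] := k01 w;
        apply/andP; split; nra.
    + by apply: measurable_funM; exact: measurable_trig_poly.
    + by move=> w; have /andP[h0 h1] := f01 (ev w); have /andP[k0 k1] := g01 (ev w);
        apply/andP; split; nra.
  - by apply: Rintegrable_add; exact: dist_integrable.
  - move=> w _.
    have -> : h w * k w - f (ev w) * g (ev w) =
        (h w - f (ev w)) * k w + f (ev w) * (k w - g (ev w)) by ring.
    have /andP[h0 h1] := f01 (ev w); have /andP[k0 k1] := k01 w.
    apply: (le_trans (ler_normD _ _)); rewrite !normrM lerD//.
      by rewrite ler_piMr// ger0_norm.
    by rewrite ler_piMl// ger0_norm.
rewrite RintegralD//; [lra|exact: dist_integrable..].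
Qed.

(** Bounded convergence turns the pointwise limit into an [L^1]-limit; a term [h_ n] within [e / 2]
    of [h] is then approximated within [e / 2]. *)
Lemma trig_approx_lim (h_ : nat -> T -> R) h : (forall n, trig_approx (h_ n)) ->
  (forall w, h_ n w @[n --> \oo] --> h w) -> trig_approx h.
Proof.
move=> ah hh.
have mh : measurable_fun setT h.
  apply: (measurable_fun_cvg (h := h_)) => [n|w _]; last exact: hh.
  by have [] := ah n.
have h01 w : 0 <= h w <= 1.
  apply/andP; split.
  - rewrite -(cvg_lim _ (hh w))//; apply: limr_ge; first by apply/cvg_ex; exists (h w).
    by apply: nearW => n; have [_ /(_ w)/andP[]] := ah n.
  - rewrite -(cvg_lim _ (hh w))//; apply: limr_le; first by apply/cvg_ex; exists (h w).
    by apply: nearW => n; have [_ /(_ w)/andP[]] := ah n.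
have ih := unit_integrable mh h01.
have ih_ n : P.-integrable setT (EFin \o h_ n).
  by have [mn n01 _] := ah n; exact: unit_integrable.
split=> // e e0.
have e2 : 0 < e / 2 by rewrite divr_gt0.
have L1 : (fun n => \int[P]_w `|h w - h_ n w|) @ \oo --> (0 : R).
  have D := @dominated_cvg _ _ _ P setT measurableT
    (fun n w => `|h w - h_ n w|%:E) (cst 0%E) (cst 1%E).
  have : (\int[P]_w (`|h w - h_ n w|%:E))%E @[n --> \oo] --> 0%E.
    rewrite -[X in _ --> X](_ : (\int[P]_w (cst 0%E w))%E = 0%E); last first.
      by rewrite integral_cst// mul0e.
    apply: D => //.
    - move=> n; apply: measurable_int (dist_integrable ih (ih_ n)).
    - move=> w _; apply: cvg_EFin; first exact: nearW.
      rewrite -(normr0 R) -(subrr (h w)); apply: cvg_norm.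
      by apply: cvgB; [exact: cvg_cst|exact: hh].
    - by apply: (@unit_integrable (cst 1)) => // w; rewrite /cst ler01 lexx.
    - move=> n w _; rewrite /= lee_fin normr_id.
      have /andP[h0 h1] := h01 w; have [_ /(_ w)/andP[k0 k1] _] := ah n.
      by rewrite ler_norml; apply/andP; split; lra.
  by move=> /fine_cvg.
have [n hn] : exists n, \int[P]_w `|h w - h_ n w| <= e / 2.
  have /cvgrPdist_le /(_ _ e2)[N _ /(_ N (leqnn N))] := L1.
  by rewrite /= sub0r normrN => hN; exists N; apply: le_trans hN; exact: ler_norm.
have [mn n01 /(_ _ e2) [f [tf f01 hf]]] := ah n.
have if_ := unit_integrable (measurable_trig_poly tf) (fun w => f01 (ev w)).
exists f; split => //.
apply: (@le_trans _ _ (\int[P]_w (`|h w - h_ n w| + `|h_ n w - f (ev w)|))).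
  apply: le_Rintegral => //.
  - exact: dist_integrable.
  - by apply: Rintegrable_add; exact: dist_integrable.
  - by move=> w _; exact: ler_distD.
by rewrite RintegralD//; [lra|exact: dist_integrable..].
Qed.

End Class.
End Approximation.

(** * Approximation of the events of the generated sigma-field *)

Section SigmaApproximation.
Context d (T : measurableType d) (R : realType) (P : probability T R).
Variable G : set (L2 P).

(** An odd polynomial map of [-1, 1] into itself with attracting fixed points -1 and 1 and repelling
    fixed point 0; being polynomial, it preserves trigonometric polynomials. *)
Definition sharpen (w : R) : R := (3 * w - w ^+ 3) / 2.

Lemma sharpen_bound w : -1 <= w <= 1 -> -1 <= sharpen w <= 1.
Proof.
move=> /andP[w1 w2]; rewrite /sharpen.
have h1 : 1 - (3 * w - w ^+ 3) / 2 = (1 - w) ^+ 2 * (2 + w) / 2 by field.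
have h2 : (3 * w - w ^+ 3) / 2 + 1 = (1 + w) ^+ 2 * (2 - w) / 2 by field.
apply/andP; split.
  by rewrite -subr_ge0 opprK h2 divr_ge0// mulr_ge0 ?sqr_ge0//; lra.
by rewrite -subr_ge0 h1 divr_ge0// mulr_ge0 ?sqr_ge0//; lra.
Qed.

Lemma iter_sharpen_bound n w : -1 <= w <= 1 -> -1 <= iter n sharpen w <= 1.
Proof. by move=> w1; elim: n => //= n ih; exact: sharpen_bound. Qed.

Lemma iter_sharpenN n w : iter n sharpen (- w) = - iter n sharpen w.
Proof. by elim: n => //= n ->; rewrite /sharpen; field. Qed.

Lemma iter_sharpen_cvg w : -1 <= w <= 1 ->
  iter n sharpen w @[n --> \oo] --> Num.sg w.
Proof.
have pos v : 0 < v <= 1 -> iter n sharpen v @[n --> \oo] --> (1 : R).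
  move=> /andP[v0 v1].
  (* The iterates [z] stay above [v], so each step multiplies the distance to 1 by
     [1 - (z + z^2) / 2 <= 1 - v / 2]. *)
  have b n : v <= iter n sharpen v <= 1 /\ 1 - iter n sharpen v <= (1 - v / 2) ^+ n.
    elim: n => [|n [/andP[h1 h2] h3]]; first by rewrite /= expr0 lexx v1; split=> //; lra.
    rewrite iterS exprS; move: h1 h2 h3; set z := iter n sharpen v => h1 h2 h3.
    have e1 : sharpen z - z = z * ((1 - z) * (1 + z)) / 2 by rewrite /sharpen; field.
    have e2 : 1 - sharpen z = (1 - z) * (1 - (z + z ^+ 2) / 2) by rewrite /sharpen; field.
    have p1 : 0 <= sharpen z - z by rewrite e1 divr_ge0// !mulr_ge0//; lra.
    have /andP[_ p2] : -1 <= sharpen z <= 1 by apply: sharpen_bound; apply/andP; split; lra.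
    split; first by apply/andP; split; lra.
    rewrite e2 mulrC ler_pM//; [|lra|].
      by have : z ^+ 2 <= 1; nra.
    by have := sqr_ge0 z; lra.
  have k1 : `|1 - v / 2| < 1 by rewrite ger0_norm; lra.
  apply: (@squeeze_cvgr _ _ _ _ (fun n => 1 - (1 - v / 2) ^+ n) (cst 1)).
  - by apply: nearW => n; have [/andP[_ h2] h3] := b n; apply/andP; split=> //; lra.
  - rewrite -[X in _ --> X]subr0; apply: cvgB; first exact: cvg_cst.
    exact: cvg_expr.
  - exact: cvg_cst.
move=> /andP[w1 w2]; have [->|w0|w0] := sgrP w.
- rewrite (_ : (fun n : nat => _) = cst 0); first exact: cvg_cst.
  by apply/funext; elim=> //= n ->; rewrite /sharpen; field.
- by apply: pos; apply/andP; split.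
- rewrite (_ : (fun n : nat => _) = fun n => - iter n sharpen (- w)); last first.
    by apply/funext => n; rewrite iter_sharpenN opprK.
  by apply: cvgN; apply: pos; apply/andP; split; lra.
Qed.

Lemma trig_poly_sharpen (I : Type) n (f : (I -> R) -> R) :
  trig_poly f -> trig_poly (fun x => iter n sharpen (f x)).
Proof.
move=> tf; elim: n => [//|n [t ih]].
have tg : trig_poly (fun x => iter n sharpen (f x)) by exists t.
have [u hu] : trig_poly (fun x => 3 / 2 * iter n sharpen (f x) +
    (- 2^-1) * (iter n sharpen (f x) * (iter n sharpen (f x) * iter n sharpen (f x)))).
  apply: trig_polyD; apply: trig_polyZ => //.
  by apply: trig_polyM => //; exact: trig_polyM.
by exists u => x; rewrite -hu iterS /sharpen; field.
Qed.

Lemma trig_approx_pow (h : T -> R) n : trig_approx G h ->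
  trig_approx G (fun w => h w ^+ n).
Proof.
move=> ah; elim: n => [|n ih].
  by apply: (@trig_approx_trig _ _ _ _ _ (fun _ => 1)); [exact: trig_poly_cst|
    move=> x; rewrite ler01 lexx].
under eq_fun do rewrite exprS.
exact: trig_approx_mul.
Qed.

(** For large [n] the argument lies in []-2, 2[], where the sine has the sign of its argument. *)
Lemma sg_sin_cvg (u : R) : Num.sg (sin (u / n.+1%:R)) @[n --> \oo] --> Num.sg u.
Proof.
have pos v : 0 < v -> \forall n \near \oo, 0 < sin (v / n.+1%:R).
  move=> v0; near=> n; apply: sin2_gt0; rewrite divr_gt0//=.
  rewrite ltr_pdivrMr// (@lt_le_trans _ _ n.+1%:R)//.
    rewrite (@lt_trans _ _ n%:R)// ?ltr_nat//.
    by near: n; exact: nbhs_infty_gtr.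
  by rewrite ler_peMl// ler1n.
apply: cvg_near_cst; have [->|u0|u0] := sgrP u.
- by apply: nearW => n; rewrite mul0r sin0 sgr0.
- by near=> n; apply: gtr0_sg; near: n; exact: pos.
- have : \forall n \near \oo, 0 < sin (- u / n.+1%:R) by apply: pos; lra.
  by apply: filterS => n; rewrite mulNr sinN oppr_gt0 => /ltr0_sg.
Unshelve. all: by end_near. Qed.

(** Three successive limits: iterates of [sharpen] give the sign of [sin ((X - a) / (k + 1))], large
    [k] gives the sign of [X - a], and powers give the indicator. *)
Lemma trig_approx_ray (X : L2 P) (a : R) : G X ->
  trig_approx G (\1_[set w | a < X w]).
Proof.
move=> GX; pose i : set_type G := exist _ X (mem_set GX).
have s1 k : trig_approx G (fun w => (1 + Num.sg (sin ((X w - a) / k.+1%:R))) / 2).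
  (* The phase [- pi / 2] turns the cosine into a sine. *)
  pose f n (x : set_type G -> R) :=
    2^-1 * (1 + iter n sharpen (cos ((- (a / k.+1%:R) - pi / 2) + k.+1%:R^-1 * x i))).
  apply: (@trig_approx_lim _ _ _ _ _ (fun n w => f n (@eval_at _ _ _ P G w))) => [n|w].
    apply: trig_approx_trig.
      apply: trig_polyZ; apply: trig_polyD; first exact: trig_poly_cst.
      by apply: trig_poly_sharpen; exact: trig_poly_cos.
    move=> x; rewrite /f.
    have := @iter_sharpen_bound n (cos ((- (a / k.+1%:R) - pi / 2) + k.+1%:R^-1 * x i)).
    rewrite cos_geN1 cos_le1 => /(_ isT) /andP[h1 h2].
    by apply/andP; split; lra.
  rewrite /f; under eq_fun do rewrite mulrC.
  apply: cvgM; last exact: cvg_cst.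
  apply: cvgD; first exact: cvg_cst.
  have -> : - (a / k.+1%:R) - pi / 2 + k.+1%:R^-1 * eval_at w i =
      (X w - a) / k.+1%:R - pi / 2.
    by rewrite /eval_at/=; ring.
  rewrite cosBpihalf; apply: iter_sharpen_cvg.
  by rewrite sin_geN1 sin_le1.
have s2 : trig_approx G (fun w => (1 + Num.sg (X w - a)) / 2).
  apply: (trig_approx_lim s1) => w.
  apply: cvgM; last exact: cvg_cst.
  by apply: cvgD; [exact: cvg_cst|exact: sg_sin_cvg].
(* Where [X = a] the function equals 1/2; its powers send this value to 0 and keep the value 1. *)
apply: (trig_approx_lim (h_ := fun n w => ((1 + Num.sg (X w - a)) / 2) ^+ n)) => [n|w].
  exact: trig_approx_pow.
have [aX|aX] := ltP a (X w).
  rewrite gtr0_sg ?subr_gt0// indicE mem_set//.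
  rewrite (_ : (fun n : nat => _) = cst 1); first exact: cvg_cst.
  by apply/funext => n; rewrite /cst (_ : (1 + 1) / 2 = 1 :> R) ?expr1n//; field.
rewrite indicE memNset/=; last by apply/negP; rewrite -leNgt.
apply: cvg_expr.
have : Num.sg (X w - a) <= 0 by rewrite sgr_le0 subr_le0.
have : -1 <= Num.sg (X w - a) by have [_|_|_] := sgrP (X w - a); lra.
by move=> h1 h2; rewrite ger0_norm; lra.
Qed.

Lemma trig_approx_setC (A : set T) : trig_approx G (\1_A) -> trig_approx G (\1_(~` A)).
Proof.
move=> /trig_approx_compl; congr trig_approx; apply/funext => w.
rewrite !indicE in_setC; case: (w \in A); rewrite ?subrr ?subr0//.
Qed.

(** The indicator of the complement is the limit of finite products of complementary indicators. *)
Lemma trig_approx_bigcup (A : (set T)^nat) : (forall n, trig_approx G (\1_(A n))) ->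
  trig_approx G (\1_(\bigcup_n A n)).
Proof.
move=> ah; suff : trig_approx G (\1_(~` \bigcup_n A n)).
  by move=> /trig_approx_setC; rewrite setCK.
have prodE w n : \prod_(i < n) (1 - \1_(A i) w) = \1_(~` \bigcup_(i < n) A i) w :> R.
  elim: n => [|n ih].
    by rewrite big_ord0 bigcup_mkord big_ord0 setC0 indicT.
  rewrite big_ord_recr ih/= !bigcup_mkord big_ord_recr/= setCU indicI.
  by congr (_ * _); rewrite !indicE in_setC; case: (w \in A n); rewrite ?subrr ?subr0.
apply: (trig_approx_lim (h_ := fun n w => \prod_(i < n) (1 - \1_(A i) w))) => [n|w].
  elim: n => [|n ih].
    under eq_fun do rewrite big_ord0.
    by apply: (@trig_approx_trig _ _ _ _ _ (fun _ => 1)); [exact: trig_poly_cst|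
      move=> x; rewrite ler01 lexx].
  under eq_fun do rewrite big_ord_recr/=.
  by apply: trig_approx_mul => //; exact: trig_approx_compl.
apply: cvg_near_cst.
have [[N _ AN]|nA] := pselect ((\bigcup_n A n) w).
- near=> n; rewrite prodE !indicE !memNset//; first by move=> h; apply: h; exists N.
  move=> h; apply: h; exists N => //=; near: n; exact: nbhs_infty_gt.
- apply: nearW => n; rewrite prodE !indicE !mem_set//.
  by move=> [i _ Ai]; apply: nA; exists i.
Unshelve. all: by end_near. Qed.

(** Approximable events form a sigma-algebra, so generators suffice, twice: first preimages of Borel
    sets under elements of [G], then open rays among the Borel sets. *)
Lemma trig_approx_sigma (A : set T) : <<s sigma_gen G >> A -> trig_approx G (\1_A).
Proof.
have approx0 : trig_approx G (\1_(set0 : set T)).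
  rewrite (_ : \1_set0 = cst 0); last by apply/funext => w; rewrite indicE in_set0.
  by apply: (@trig_approx_trig _ _ _ _ _ (fun _ => 0)); [exact: trig_poly_cst|
    move=> x; rewrite lexx ler01].
apply: (@smallest_sub _ _ _ [set A | trig_approx G (\1_A)]).
  split=> //= [B|B]; first by rewrite setTD; exact: trig_approx_setC.
  exact: trig_approx_bigcup.
move=> _ [X GX [B mB <-]] /=; rewrite setTI.
move: mB; rewrite [measurable](@RGenOInfty.measurableE R).
apply: (@smallest_sub _ _ _ [set B | trig_approx G (\1_(X @^-1` B))]).
  split=> /= [|C|C]; first by rewrite preimage_set0.
    by rewrite setTD preimage_setC; exact: trig_approx_setC.
  by rewrite preimage_bigcup; exact: trig_approx_bigcup.
move=> _ [a ->] /=.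
rewrite (_ : _ @^-1` _ = [set w | a < X w]); first exact: trig_approx_ray.
by apply/seteqP; split=> w /=; rewrite in_itv/= andbT.
Qed.

End SigmaApproximation.

(** * Maximal correlation and the bound for pairs of events *)

Section MaximalCorrelation.
Context d (T : measurableType d) (R : realType) (P : probability T R).
Implicit Types (X Y : L2 P) (G : set (L2 P)).

Lemma norm2E X : norm2 X = Num.sqrt (inner X X).
Proof.
have n0 : 0 <= norm2 X by rewrite fine_ge0// Lnorm_ge0.
rewrite -[LHS](ger0_norm n0) -sqrtr_sqr; congr Num.sqrt.
have := powR_Lnorm P (EFin \o X) (_ : 2%R != 0 :> R).
rewrite pnatr_eq0 => /(_ isT).
rewrite -(finite_norm_fine X) -/(norm2 X) poweR_EFin powR_mulrn//.
move=> h; apply: EFin_inj; rewrite h /inner /Rintegral fineK; last first.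
  by apply: integrable_fin_num => //; exact: L2_mul_integrable.
apply: eq_integral => w _ /=.
by rewrite powR_mulrn// real_normK ?num_real// expr2.
Qed.

Lemma covariance_L2 X Y : covariance P X Y =
  (inner X Y - (\int[P]_w X w) * (\int[P]_w Y w))%:E.
Proof.
have X2 := LfunP X; have Y2 := LfunP Y.
have fin : P setT \is a fin_num by exact: fin_num_measure.
have X1 := Lfun_subset12 fin X2; have Y1 := Lfun_subset12 fin Y2.
have XY1 := Lfun2_mul_Lfun1 X2 Y2.
rewrite covarianceE// unlock /inner /Rintegral EFinB EFinM !fineK//.
- by apply: integrable_fin_num => //; exact: L2_integrable.
- by apply: integrable_fin_num => //; exact: L2_integrable.
- by apply: integrable_fin_num => //; exact: L2_mul_integrable.
Qed.

(** Cauchy-Schwarz for covariances, and a variance is at most the second moment. *)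
Lemma covariance_le_norm2 X Y : fine (covariance P X Y) <= norm2 X * norm2 Y.
Proof.
have V (Z : L2 P) : ('V_P[Z] <= (inner Z Z)%:E)%E.
  rewrite /variance covariance_L2 lee_fin.
  by have := sqr_ge0 (\int[P]_w Z w); nra.
have h := covariance_le (LfunP X) (LfunP Y).
rewrite -lee_fin fineK; last by rewrite covariance_L2.
apply: (le_trans h).
have sq (Z : L2 P) : (sqrte 'V_P[Z] <= (norm2 Z)%:E)%E.
  rewrite norm2E -[leRHS]/(sqrte (inner Z Z)%:E).
  by rewrite lee_sqrt ?lee_fin ?inner_ge0.
by rewrite EFinM; apply: lee_pmul => //; exact: sqrte_ge0.
Qed.

Section Gaussian.
Variables (H1 H2 : set (L2 P)).
Hypothesis (cH1 : closed_subspace H1) (cH2 : closed_subspace H2).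

Let corr_set : set R := [set fine (covariance P X1 X2) / (norm2 X1 * norm2 X2)
  | X1 in L2_of H1 & X2 in L2_of H2].

Lemma sub_L2_of G : G `<=` L2_of G.
Proof.
move=> X GX; rewrite /L2_of /= /sigma_measurable => _ B mB.
rewrite setTI; apply: sub_sigma_algebra; exists X => //.
by exists B => //; rewrite setTI.
Qed.

(** Needed because [sup] is a least upper bound only for a nonempty bounded set. *)
Let corr_ub : ubound corr_set 1.
Proof.
move=> _ [X _ [Y _ <-]].
have n0 : 0 <= norm2 X * norm2 Y by rewrite !norm2E mulr_ge0 ?sqrtr_ge0.
have [->|n1] := eqVneq (norm2 X * norm2 Y) 0; first by rewrite invr0 mulr0.
by rewrite ler_pdivrMr ?mul1r ?covariance_le_norm2// lt_neqAle eq_sym n1.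
Qed.

Let corr_le X Y : L2_of H1 X -> L2_of H2 Y ->
  fine (covariance P X Y) / (norm2 X * norm2 Y) <= maximal_correlation H1 H2.
Proof.
move=> hX hY; apply: ub_le_sup; first by exists 1; exact: corr_ub.
by exists X => //; exists Y.
Qed.

Let mem0 G : closed_subspace G -> G 0.
Proof. by move=> [[G0 _] _]; exact/set_mem. Qed.

(** The pair of zero variables has ratio 0 by [x / 0 = 0], whence the lower bound; so [|rho| = rho]
    in the theorem. *)
Lemma maximal_correlation_itv : 0 <= maximal_correlation H1 H2 <= 1.
Proof.
have z1 := sub_L2_of (mem0 cH1); have z2 := sub_L2_of (mem0 cH2).
apply/andP; split.
  have := corr_le z1 z2.
  by rewrite norm2E inner0l sqrtr0 mul0r invr0 mulr0.
by apply: ge_sup corr_ub; eexists; exists 0 => //; exists 0.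
Qed.

(** Elements of [H1] are centered, so their covariances are inner products; replacing [X] by [-X],
    of the same norm, gives the absolute value. *)
Lemma inner_le_maximal_correlation X Y :
  (forall Z, H1 Z -> centered_gaussian P Z) -> H1 X -> H2 Y ->
  `|inner X Y| <= maximal_correlation H1 H2 *
    (Num.sqrt (inner X X) * Num.sqrt (inner Y Y)).
Proof.
move=> gH1 HX HY; rewrite -!norm2E.
have n0 : 0 <= norm2 X * norm2 Y by rewrite !norm2E mulr_ge0 ?sqrtr_ge0.
have covE Z : H1 Z -> fine (covariance P Z Y) = inner Z Y.
  move=> HZ; have [EZ _] := centered_gaussian_moments (gH1 _ HZ).
  by rewrite covariance_L2 EZ mul0r subr0.
have main Z : H1 Z -> norm2 Z = norm2 X ->
    inner Z Y <= maximal_correlation H1 H2 * (norm2 X * norm2 Y).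
  (* If a norm vanishes the ratio carries no information, and Cauchy-Schwarz is used directly. *)
  move=> HZ ZX; have [n1|n1] := eqVneq (norm2 X * norm2 Y) 0.
    by rewrite n1 mulr0 -n1 -ZX -covE// covariance_le_norm2.
  have n2 : 0 < norm2 X * norm2 Y by rewrite lt_neqAle eq_sym n1.
  rewrite -ler_pdivrMr// -ZX -covE//.
  by apply: corr_le; exact: sub_L2_of.
rewrite ler_norml lerNl; apply/andP; split; last exact: main.
have NX : inner (-1 *: X) Y = - inner X Y by rewrite innerZl mulN1r.
rewrite -NX; apply: main; first exact: closed_subspaceZ.
by rewrite !norm2E innerZl innerC innerZl mulN1r mulN1r opprK.
Qed.

End Gaussian.

(** Both indicators are approximated in [L^1] within [e], [trig_hypercontractive] is applied to the
    approximations, and [powR_le_limit] removes [e]. *)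
Lemma sigma_correlation (H H1 H2 : set (L2 P)) (A B : set T) :
  gaussian_hilbert_space H -> closed_subspace H1 -> closed_subspace H2 ->
  H1 `<=` H -> H2 `<=` H ->
  <<s sigma_gen H1 >> A -> <<s sigma_gen H2 >> B ->
  fine (P (A `&` B)) <=
  (fine (P A) * fine (P B)) `^ (1 + maximal_correlation H1 H2)^-1.
Proof.
move=> gH cH1 cH2 H1H H2H sA sB; set r := maximal_correlation H1 H2.
have r01 : 0 <= r <= 1 by exact: maximal_correlation_itv.
have [r0 r1] := andP r01.
have corr X Y : H1 X -> H2 Y ->
    `|inner X Y| <= r * (Num.sqrt (inner X X) * Num.sqrt (inner Y Y)).
  by apply: inner_le_maximal_correlation => // Z /H1H; exact: gH.2.
have [mA' A01 aA] := trig_approx_sigma sA.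
have [mB' B01 aB] := trig_approx_sigma sB.
have mA : measurable A by exact/(measurable_indicP R).
have mB : measurable B by exact/(measurable_indicP R).
have PE C : measurable C -> fine (P C) = \int[P]_w \1_C w.
  by move=> mC; rewrite /Rintegral integral_indic// setIT.
have p01 C : measurable C -> 0 <= fine (P C) <= 1.
  move=> mC; rewrite fine_ge0//= -lee_fin fineK ?fin_num_measure//.
  exact: probability_le1.
rewrite PE; last exact: measurableI.
have /andP[pA0 pA1] := p01 A mA; have /andP[pB0 pB1] := p01 B mB.
apply: powR_le_limit => [||e /andP[e0 e1]]; [exact: mulr_ge0|by rewrite invr_gt0; lra|].
have [f [tf f01 fA]] := aA _ e0; have [g [tg g01 gB]] := aB _ e0.
pose ev1 := @eval_at _ _ _ P H1; pose ev2 := @eval_at _ _ _ P H2.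
rewrite -/ev1 in fA; rewrite -/ev2 in gB.
have mf : measurable_fun setT (fun w => f (ev1 w)) by exact: measurable_trig_poly.
have mg : measurable_fun setT (fun w => g (ev2 w)) by exact: measurable_trig_poly.
have iA := unit_integrable P mA' A01; have iB := unit_integrable P mB' B01.
have if_ := unit_integrable P mf (fun w => f01 (ev1 w)).
have ig := unit_integrable P mg (fun w => g01 (ev2 w)).
have ifg : P.-integrable setT (EFin \o (fun w => f (ev1 w) * g (ev2 w))).
  apply: unit_integrable; first exact: measurable_funM.
  by move=> w; have /andP[? ?] := f01 (ev1 w); have /andP[? ?] := g01 (ev2 w);
    apply/andP; split; nra.
have idA := dist_integrable iA if_; have idB := dist_integrable iB ig.
have h1 : \int[P]_w \1_(A `&` B) w <= \int[P]_w (f (ev1 w) * g (ev2 w)) + 2 * e.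
  apply: (@le_trans _ _ (\int[P]_w (f (ev1 w) * g (ev2 w) +
      (`|\1_A w - f (ev1 w)| + `|\1_B w - g (ev2 w)|)))).
    apply: le_Rintegral => //.
    - apply: unit_integrable; first exact/(measurable_indicP R)/measurableI.
      by move=> w; rewrite indicE; case: (_ \in _); rewrite ?lexx ?ler01.
    - by apply: Rintegrable_add => //; exact: Rintegrable_add.
    - move=> w _; rewrite indicI.
      have /andP[? ?] := f01 (ev1 w); have /andP[? ?] := g01 (ev2 w).
      have /andP[? ?] := A01 w; have /andP[? ?] := B01 w.
      have := ler_norm (\1_A w - f (ev1 w)); have := ler_norm (\1_B w - g (ev2 w)).
      have := normr_ge0 (\1_A w - f (ev1 w)); have := normr_ge0 (\1_B w - g (ev2 w)).
      set x := `|_|; set y := `|_| => *.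
      change (\1_A w * \1_B w <= f (ev1 w) * g (ev2 w) + (y + x)).
      (* The difference of the products is split as [(\1_A - f) \1_B + f (\1_B - g)]. *)
      have : (\1_A w - f (ev1 w)) * \1_B w <= y.
        apply: (@le_trans _ _ (y * \1_B w)); first by rewrite ler_wpM2r.
        by rewrite ler_piMr.
      have : f (ev1 w) * (\1_B w - g (ev2 w)) <= x.
        apply: (@le_trans _ _ (f (ev1 w) * x)); first by rewrite ler_wpM2l.
        by rewrite ler_piMl.
      by lra.
  rewrite RintegralD//; last exact: Rintegrable_add.
  by rewrite (RintegralD measurableT idA idB); lra.
have le_e (h k : T -> R) : P.-integrable setT (EFin \o h) ->
    P.-integrable setT (EFin \o k) -> \int[P]_w `|h w - k w| <= e ->
    \int[P]_w k w <= \int[P]_w h w + e.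
  move=> ih ik hk; rewrite -lerBlDl -RintegralB//; apply: le_trans hk.
  apply: le_Rintegral => //; first exact: Rintegrable_sub.
    exact: dist_integrable.
  by move=> w _; rewrite distrC ler_norm.
have h2 := le_e _ _ iA if_ fA; have h3 := le_e _ _ iB ig gB.
rewrite -PE// in h2; rewrite -PE// in h3.
have f0 : 0 <= \int[P]_w f (ev1 w).
  by apply: Rintegral_ge0 => w _; case/andP: (f01 (ev1 w)).
have g0 : 0 <= \int[P]_w g (ev2 w).
  by apply: Rintegral_ge0 => w _; case/andP: (g01 (ev2 w)).
have := trig_hypercontractive gH cH1 cH2 H1H H2H r01 corr tf tg f01 g01.
rewrite -/ev1 -/ev2 => h4.
have h5 : ((\int[P]_w f (ev1 w)) * (\int[P]_w g (ev2 w))) `^ (1 + r)^-1 <=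
    (fine (P A) * fine (P B) + 3 * e) `^ (1 + r)^-1.
  apply: ge0_ler_powR; rewrite ?nnegrE ?invr_ge0 ?mulr_ge0//; [lra|nra|].
  apply: (@le_trans _ _ ((fine (P A) + e) * (fine (P B) + e))); first exact: ler_pM.
  by nra.
by lra.
Qed.

End MaximalCorrelation.

(** * The tail bound and extremal independence *)

Lemma ereal_at_left_filter (R : realType) (u : \bar R) :
  Filter (ereal_at_left u).
Proof. by case: u => [r| |] /=; exact: _. Qed.

Theorem corollary3p4 (R : realType) (d : measure_display)
    (T : measurableType d) (P : probability T R) (H H1 H2 : set (L2 P))
    (hH : gaussian_hilbert_space H)
    (hH1 : closed_subspace H1) (H1H : H1 `<=` H)
    (hH2 : closed_subspace H2) (H2H : H2 `<=` H) :
  let rho := maximal_correlation H1 H2 in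
  (forall Y1 Y2 : {RV P >-> R},
     sigma_measurable H1 (Y1 : T -> R) -> sigma_measurable H2 (Y2 : T -> R) ->
     has_law P Y1 (distribution P Y2) ->
     forall x : R,
       (P [set t | (x < Y1 t)%R /\ (x < Y2 t)%R]
          <= P [set t | (x < Y1 t)%R] `^ (2 / (1 + `|rho|)))%E /\
       (P [set t | (x < Y1 t)%R] `^ (2 / (1 + `|rho|))
          = ccdf Y1 x `^ (2 / (1 + `|rho|)))%E) /\
  (forall (m n : nat) (V1 : {RV P >-> m.-tuple R}) (V2 : {RV P >-> n.-tuple R})
     (mu : probability R R),
     sigma_measurable H1 (V1 : T -> m.-tuple R) ->
     sigma_measurable H2 (V2 : T -> n.-tuple R) ->
     (forall i : 'I_m, has_law P (fun t => tnth (V1 t) i) mu) ->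
     (forall j : 'I_n, has_law P (fun t => tnth (V2 t) j) mu) ->
     continuous_at_upper_end_point (distribution_fun mu) ->
     `|rho| < 1 ->
     extremally_independent_vectors P (distribution_fun mu) V1 V2).
Proof.
move=> rho.
have /andP[rho0 rho1] : 0 <= rho <= 1 by exact: maximal_correlation_itv.
have rayE (Y : T -> R) (x : R) : Y @^-1` `]x, +oo[%classic = [set t | x < Y t].
  by apply/seteqP; split=> w /=; rewrite in_itv/= andbT.
have bound (Y1 Y2 : T -> R) x : sigma_measurable H1 Y1 -> sigma_measurable H2 Y2 ->
    P [set t | x < Y1 t] = P [set t | x < Y2 t] ->
    fine (P [set t | x < Y1 t /\ x < Y2 t]) <=
    fine (P [set t | x < Y1 t]) `^ (2 / (1 + `|rho|)).
  move=> s1 s2 eqP12.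
  have a1 : <<s sigma_gen H1 >> [set t | x < Y1 t].
    by rewrite -rayE -[X in <<s _ >> X]setTI; apply: s1 => //; exact: measurable_itv.
  have a2 : <<s sigma_gen H2 >> [set t | x < Y2 t].
    by rewrite -rayE -[X in <<s _ >> X]setTI; apply: s2 => //; exact: measurable_itv.
  have := sigma_correlation hH hH1 hH2 H1H H2H a1 a2.
  (* Equal tails turn the product of probabilities into a square, whence the exponent
     [2 / (1 + rho)]. *)
  rewrite -eqP12 -/rho ger0_norm// -expr2 -powR_mulrn ?fine_ge0//.
  by rewrite -powRrM.
split.
  move=> Y1 Y2 s1 s2 law x; split; last by rewrite /ccdf /distribution /pushforward rayE.
  have m1 : measurable [set t | x < Y1 t].
    by rewrite -rayE -[X in measurable X]setTI; exact: measurable_funP.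
  have m2 : measurable [set t | x < Y2 t].
    by rewrite -rayE -[X in measurable X]setTI; exact: measurable_funP.
  have e : P [set t | x < Y1 t] = P [set t | x < Y2 t].
    have := law `]x, +oo[%classic (measurable_itv _).
    by rewrite /distribution /pushforward !rayE.
  have := bound _ _ x s1 s2 e.
  rewrite -lee_fin -poweR_EFin !fineK//; apply: fin_num_measure => //.
  exact: measurableI.
move=> m n V1 V2 mu s1 s2 law1 law2 cont rho_lt1 i j.
rewrite /extremally_independent.
pose F := distribution_fun mu; rewrite -/F in cont *.
have FF : Filter (ereal_at_left (upper_end_point F)) by exact: ereal_at_left_filter.
pose Y1 t := tnth (V1 t) i; pose Y2 t := tnth (V2 t) j.
have m1 : sigma_measurable H1 Y1 by exact: measurableT_comp (measurable_tnth i) s1.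
have m2 : sigma_measurable H2 Y2 by exact: measurableT_comp (measurable_tnth j) s2.
have E1 x : P [set t | x < Y1 t] = mu `]x, +oo[%classic.
  by rewrite -(law1 i) /pushforward ?rayE//; exact: measurable_itv.
have E2 x : P [set t | x < Y2 t] = mu `]x, +oo[%classic.
  by rewrite -(law2 j) /pushforward ?rayE//; exact: measurable_itv.
have F1 x : (1 - F x)%E = mu `]x, +oo[%classic.
  rewrite /F /distribution_fun -probability_setC; last exact: measurable_itv.
  by rewrite setCitvl.
pose q x := fine (1 - F x)%E.
have qE x : q x = fine (P [set t | x < Y1 t]) by rewrite E1 -F1.
have q0 x : 0 <= q x by rewrite qE fine_ge0.
(* The exponent left after division by the tail; for [rho >= 0] it is positive exactly when
   [rho < 1]. *)
pose c := 2 / (1 + rho) - 1.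
have c0 : 0 < c.
  rewrite ger0_norm// in rho_lt1.
  by rewrite /c subr_gt0 ltr_pdivlMr; lra.
have ratio_le x : fine (P [set t | x < Y1 t /\ x < Y2 t]) / q x <= q x `^ c.
  (* Where the tail vanishes, the ratio is 0 by [x / 0 = 0]. *)
  have [->|qn0] := eqVneq (q x) 0; first by rewrite invr0 mulr0 powR_ge0.
  have qp : 0 < q x by rewrite lt_neqAle eq_sym qn0 q0.
  rewrite ler_pdivrMr// mulrC mulr_powRB1//.
    have := bound Y1 Y2 x m1 m2; rewrite E1 E2 -E1 -qE ger0_norm// => /(_ erefl).
    by [].
  by rewrite divr_gt0//; lra.
(* Continuity at the upper end point enters here. *)
have qcvg : q x @[x --> ereal_at_left (upper_end_point F)] --> (0 : R).
  have : (1 - F x)%E @[x --> ereal_at_left (upper_end_point F)] --> 0%E.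
    rewrite -(@subee R 1%E)//; apply: cvgeB => //; exact: cvg_cst.
  by move=> /fine_cvg.
apply/cvgrPdist_le => e e0.
(* A tail below [e^(1/c)] makes the bound [q^c] at most [e]. *)
have d0 : 0 < e `^ c^-1 by exact: powR_gt0.
move/cvgrPdist_le : qcvg => /(_ _ d0); apply: filterS => x.
rewrite !sub0r !normrN (ger0_norm (q0 x)) => qx.
rewrite ger0_norm; last by apply: divr_ge0; [rewrite fine_ge0|exact: q0].
apply: (le_trans (ratio_le x)).
have -> : e = (e `^ c^-1) `^ c by rewrite -powRrM mulVf ?gt_eqF// powRr1// ltW.
by apply: ge0_ler_powR; rewrite ?nnegrE ?powR_ge0// ltW.
Qed.
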